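(* Let $n\ge 1$ and let $b,m\in C^{1}([0,\infty))$ be real-valued with $$|\partial_t^k b(t)|\le C_k\Big(\frac1{1+t}\Big)^{k+1},\qquad |\partial_t^k m(t)|\le C_k\Big(\frac1{1+t}\Big)^{k+2},\qquad k=0,1,\ t\ge 0.$$ Suppose that the limits $b_0=\lim_{t\to\infty}(1+t)b(t)$ and $m_0=\lim_{t\to\infty}(1+t)^2m(t)$ exist and that $$\int_1^\infty |t\,b(t)-b_0|\,\frac{dt}{t}<\infty,\qquad \int_1^\infty |t^2m(t)-m_0|\,\frac{dt}{t}<\infty .$$ Assume further that $b_0(b_0-2)\le 4m_0$. Put $\lambda(t)=\exp\big(\tfrac12\int_0^t b(\tau)\,d\tau\big)$. Then there is a constant $C$ such that for all $u_0\in H^1(\mathbb R^n)$, $u_1\in L^2(\mathbb R^n)$ the solution $u$ of the Cauchy problem $$u_{tt}-\Delta u+b(t)u_t+m(t)u=0,\qquad u(0,x)=u_0(x),\quad u_t(0,x)=u_1(x),\qquad (t,x)\in[0,\infty)\times\mathbb R^n,$$ satisfies for all $t\ge0$ $$\|(1+t)^{-1}u(t,\cdot)\|_{L^2}+\|\nabla u(t,\cdot)\|_{L^2}+\|u_t(t,\cdot)\|_{L^2}\le \frac{C}{\lambda(t)}\big(\|u_0\|_{H^1}+\|u_1\|_{L^2}\big).$$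
   Context: $\nabla$ and $\Delta$ act in the space variable $x\in\mathbb R^n$; norms are over $\mathbb R^n$. $H^1$ is the usual $L^2$-based Sobolev space. The constants $b_0,m_0$ are real and no sign is assumed. *)

(* Defs.v *)
From HB Require Import structures.
From mathcomp Require Import all_boot all_order all_algebra complex.
From mathcomp Require Import all_classical all_reals all_analysis.

Set Implicit Arguments.
Unset Strict Implicit.
Unset Printing Implicit Defensive.
Import Order.TTheory GRing.Theory Num.Theory.
Import numFieldNormedType.Exports.
Local Open Scope classical_set_scope.
Local Open Scope ring_scope.

Lemma sigma_finite_product d1 d2 (T1 : measurableType d1)
    (T2 : measurableType d2) (R : realType)
    (m1 : {sigma_finite_measure set T1 -> \bar R})
    (m2 : {sigma_finite_measure set T2 -> \bar R}) :
  sigma_finite setT (m1 \x m2)%E.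
Proof.
have /sigma_finiteP[F [TF ndF Foo]] := sigma_finiteT m1.
have /sigma_finiteP[G [TG ndG Goo]] := sigma_finiteT m2.
exists (fun k => F k `*` G k).
  rewrite -setXTT TF TG predeqE => -[x y]; split.
    move=> [/= [i _ Fix] [j _ Gjy]]; exists (maxn i j) => //; split.
    - by move: x Fix; exact/subsetPset/ndF/leq_maxl.
    - by move: y Gjy; exact/subsetPset/ndG/leq_maxr.
  by move=> [i _ [/= ? ?]]; split; exists i.
move=> k; have [? ?] := Foo k; have [? ?] := Goo k.
split; first exact: measurableX.
by rewrite product_measure1E// lte_mul_pinfty// ge0_fin_numE.
Qed.

Section lebesgue_tuple_step.
Context {R : realType} {n : nat}.
Variable mu : {sigma_finite_measure set (n.-tuple R) -> \bar R}.

Definition tuple_cons (p : R * n.-tuple R) : n.+1.-tuple R :=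
  [tuple of p.1 :: p.2].

Definition tuple_uncons (x : n.+1.-tuple R) : R * n.-tuple R :=
  (thead x, [tuple of behead x]).

Lemma tuple_consK : cancel tuple_cons tuple_uncons.
Proof.
by move=> [a t]; rewrite /tuple_uncons /= theadE; congr pair; exact/val_inj.
Qed.

Lemma measurable_tuple_cons : measurable_fun [set: R * n.-tuple R] tuple_cons.
Proof. exact: measurable_cons. Qed.

Lemma measurable_tuple_uncons :
  measurable_fun [set: n.+1.-tuple R] tuple_uncons.
Proof.
apply: measurable_fun_pair; first exact: measurable_tnth.
exact: measurable_behead.
Qed.

Definition lebesgue_cons : set (n.+1.-tuple R) -> \bar R :=
  pushforward (@lebesgue_measure R \x mu)%E tuple_cons.

Let lebesgue_cons0 : lebesgue_cons set0 = 0%E.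
Proof. by rewrite /lebesgue_cons /pushforward preimage_set0 measure0. Qed.

Let lebesgue_cons_ge0 A : (0 <= lebesgue_cons A)%E.
Proof. exact: (measure_ge0 (@lebesgue_measure R \x mu)%E). Qed.

Let lebesgue_cons_sigma_additive : semi_sigma_additive lebesgue_cons.
Proof.
move=> F mF tF mUF; rewrite /lebesgue_cons /pushforward preimage_bigcup.
apply: (@measure_semi_sigma_additive _ _ _ (@lebesgue_measure R \x mu)%E).
- by move=> k; rewrite -[X in measurable X]setTI; exact: measurable_tuple_cons.
- apply/trivIsetP => /= i j _ _ ij; rewrite -preimage_setI.
  by move/trivIsetP : tF => /(_ _ _ _ _ ij) ->//; rewrite preimage_set0.
- rewrite -preimage_bigcup -[X in measurable X]setTI.
  exact: measurable_tuple_cons.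
Qed.

HB.instance Definition _ := isMeasure.Build _ _ _ lebesgue_cons
  lebesgue_cons0 lebesgue_cons_ge0 lebesgue_cons_sigma_additive.

Let lebesgue_cons_sigma_finite : sigma_finite setT lebesgue_cons.
Proof.
have [F FT mF] := sigma_finite_product (@lebesgue_measure R) mu.
exists (fun k => tuple_uncons @^-1` F k).
  by rewrite -preimage_bigcup -FT preimage_setT.
move=> k; have [mFk Fk] := mF k; split.
  by rewrite -[X in measurable X]setTI; exact: measurable_tuple_uncons.
rewrite /lebesgue_cons /pushforward -comp_preimage.
rewrite (_ : _ \o _ = id) //; apply/funext => x; exact: tuple_consK.
Qed.

HB.instance Definition _ := Measure_isSigmaFinite.Build _ _ _ lebesgue_cons
  lebesgue_cons_sigma_finite.

End lebesgue_tuple_step.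

Fixpoint lebesgue_tuple (R : realType) (n : nat) :
    {sigma_finite_measure set (n.-tuple R) -> \bar R} :=
  match n with
  | 0 => \d_([tuple] : 0.-tuple R)
  | n'.+1 => lebesgue_cons (lebesgue_tuple R n')
  end.

Lemma lebesgue_tuple_box (R : realType) (n : nat) (A : 'I_n -> set R) :
  (forall i, measurable (A i)) ->
  lebesgue_tuple R n [set x | forall i, A i (tnth x i)] =
  (\prod_(i < n) lebesgue_measure (A i))%E.
Proof.
elim: n A => [|n IH] A mA.
  rewrite big_ord0 /= diracE mem_set //; by move=> [].
rewrite big_ord_recl -(IH (fun i => A (lift ord0 i))) //.
have mB : measurable [set x : n.-tuple R |
    forall i, A (lift ord0 i) (tnth x i)].
  rewrite (_ : [set _ | _] =
      \bigcap_(i in [set: 'I_n]) ((@tnth n R)^~ i @^-1` A (lift ord0 i))).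
    apply: fin_bigcap_measurable => // i _; rewrite -[X in measurable X]setTI.
    exact: measurable_tnth.
  by apply/seteqP; split => [x /= H i _|x /= H i]; [exact: H|exact: (H i I)].
rewrite /= /lebesgue_cons /pushforward.
rewrite (_ : _ @^-1` _ =
    A ord0 `*` [set x | forall i, A (lift ord0 i) (tnth x i)]); last first.
  apply/seteqP; split => [[a x] /= H|[a x] /= [Ha H] i].
    split; first exact: (H ord0).
    by move=> i; have := H (lift ord0 i); rewrite tnthS.
  case: (unliftP ord0 i) => [j ->|->] //; by rewrite tnthS.
by rewrite -product_measure1E; [|exact: mA|exact: mB].
Qed.

Section sobolev.
Context {R : realType} {n : nat}.
Local Notation Rn := (n.-tuple R).
Local Notation mu := (lebesgue_tuple R n).
Implicit Types (f g : Rn -> R[i]) (phi : 'rV[R]_n -> R) (i : 'I_n).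

(* Integration is over [n.-tuple R], which carries the product sigma-algebra;
   derivatives of test functions are taken over ['rV[R]_n], which carries the
   norm.  [row_of] identifies the two. *)
Definition row_of (x : Rn) : 'rV[R]_n := \row_i tnth x i.

Definition pd i phi : 'rV[R]_n -> R := fun x => 'D_('e_i) phi x.

Definition smooth phi := forall s : seq 'I_n,
  continuous (foldr pd phi s) /\
  forall i x, derivable (foldr pd phi s) x 'e_i.

Definition test_function phi :=
  smooth phi /\ compact (closure [set x | phi x != 0]).

Definition cintegral f : R[i] :=
  Complex (\int[mu]_x complex.Re (f x)) (\int[mu]_x complex.Im (f x)).

(* Square-integrable functions; the elements of L^2 are their classes modulo
   equality almost everywhere. *)
Definition L2 f :=
  ((fun x => complex.Re (f x)) \in Lfun mu 2%:E) /\
  ((fun x => complex.Im (f x)) \in Lfun mu 2%:E).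

Definition L2norm f : R :=
  fine 'N[mu]_2%:E[(fun x => (Normc.normc (f x))%:E)].

(* The real part of the scalar product of L^2. *)
Definition L2dot f g : R :=
  complex.Re (cintegral (fun x => f x * (g x)^*%C)).

Definition is_weak_pd i f g := forall phi, test_function phi ->
  cintegral (fun x => f x * (pd i phi (row_of x))%:C%C) =
  - cintegral (fun x => g x * (phi (row_of x))%:C%C).

Definition H1 f :=
  L2 f /\ forall i, exists g, L2 g /\ is_weak_pd i f g.

(* Determined up to equality almost everywhere when [f] is in [H1]. *)
Definition weak_pd i f : Rn -> R[i] :=
  xget (cst 0) [set g | L2 g /\ is_weak_pd i f g].

Definition gradnorm f : R :=
  Num.sqrt (\sum_(i < n) L2norm (weak_pd i f) ^+ 2).

Definition H1norm f : R := Num.sqrt (L2norm f ^+ 2 + gradnorm f ^+ 2).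

End sobolev.

Section halfline.
Context {R : realType}.
Implicit Types (f : R -> R) (t : R).

(* [s --> t] within [0, +oo[ with [s != t]; one-sided when [t = 0]. *)
Definition hl_dnbhs t := within `[0, +oo[ t^'.

Definition hl_diffquot f t : R -> R := fun s => (f s - f t) / (s - t).

Definition hl_derive f t : R := lim (hl_diffquot f t @ hl_dnbhs t).

Definition hl_C1 f :=
  (forall t, 0 <= t -> cvg (hl_diffquot f t @ hl_dnbhs t)) /\
  {within `[0, +oo[, continuous (hl_derive f)}.

End halfline.

Section solution.
Context {R : realType} {n : nat}.
Local Notation Rn := (n.-tuple R).
Implicit Types (w : R -> Rn -> R[i]).

Definition L2_continuous w := forall t, 0 <= t ->
  L2norm (w s - w t) @[s --> within `[0, +oo[ (nbhs t)] --> 0.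

Definition L2_derivative w w' := forall t, 0 <= t ->
  L2norm (fun x => ((s - t)^-1)%:C%C * (w s x - w t x) - w' t x)
    @[s --> hl_dnbhs t] --> 0.

(* [u] lies in C([0,oo); H^1) and has the L^2-valued time derivative [ut] in
   C([0,oo); L^2), and for every [t >= 0] the equation holds in the dual of
   H^1, where u_tt paired with [v] is the time derivative of (u_t, v).  Since
   [i v] lies in H^1 with [v], the real parts of the pairings suffice. *)
Definition solution (b m : R -> R) (u0 u1 : Rn -> R[i])
    (u ut : R -> Rn -> R[i]) :=
  [/\ forall t, 0 <= t -> H1 (u t) /\ L2 (ut t),
      L2_continuous u /\ forall i, L2_continuous (fun t => weak_pd i (u t)),
      L2_derivative u ut /\ L2_continuous ut,
      {ae lebesgue_tuple R n, forall x, u 0 x = u0 x} /\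
      {ae lebesgue_tuple R n, forall x, ut 0 x = u1 x}
    & forall v, H1 v -> forall t, 0 <= t ->
      hl_diffquot (fun s => L2dot (ut s) v) t @ hl_dnbhs t -->
        - (\sum_(i < n) L2dot (weak_pd i (u t)) (weak_pd i v)
           + b t * L2dot (ut t) v + m t * L2dot (u t) v)].

End solution.

(* Main.v *)
(* Put w = (1 + t)^(b0/2) and v = w u.  Then
     v_tt - Lap v + beta v_t + (mu0 / (1 + t)^2 + delta) v = 0,
   where beta = b - b0 / (1 + t), mu0 = m0 - b0^2/4 + b0/2 and
   delta = m - m0 / (1 + t)^2 - b0 beta / (2 (1 + t)).  The assumption
   b0 (b0 - 2) <= 4 m0 says mu0 >= 0, and the integral conditions say that
   |beta| and (1 + t) |delta| are integrable; no derivative of b occurs.  The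
   energy E = |v_t|^2 + |grad v|^2 + mu0 |v|^2 / (1 + t)^2 and
   Z = |v|^2 / (1 + t)^2 then satisfy
     E' <= g (E + Z),   Z' <= (E - Z) / (1 + t)
   with g integrable, which bounds both by their initial values.  Finally
   lambda / w = exp (1/2 int beta) is bounded. *)
Require Import Defs.
From mathcomp Require Import all_boot all_order all_algebra complex.
From mathcomp Require Import all_classical all_reals all_analysis.
From mathcomp Require Import measurable_realfun.
From mathcomp Require Import ring lra.

Set Implicit Arguments.
Unset Strict Implicit.
Unset Printing Implicit Defensive.
Import Order.TTheory GRing.Theory Num.Theory.
Import numFieldNormedType.Exports.
Local Open Scope classical_set_scope.
Local Open Scope ring_scope.

(** * Calculus on half-lines *)

(** In the borderline case b0 (b0 - 2) = 4 m0 the constant mu0 vanishes and E no longer controls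
    |v|^2 / (1 + t)^2; this is why Z is carried along. Gronwall's inequality for E + Z would only
    give polynomial growth, since 1 / (1 + t) is not integrable. What saves the bound is the
    difference E - Z: with Gam the integral of g, the functions P = exp(-2 Gam) E and Q = exp(-2
    Gam) Z satisfy P' <= g (Q - P) and Q' <= (P - Q) / (1 + t), so neither exceeds a common bound of
    their initial values. The space variable enters only through y = |u|^2, z = (u_t, u), X =
    |u_t|^2 and G = |grad u|^2, tied by z^2 <= X y; the rest concerns real functions of t. The
    delicate equation is the one for X + G, because u_tt exists only in the dual of H^1 while u_t is
    merely in L^2, so that the two cannot be paired. *)

Section real_calculus.
Context {R : realType}.
Implicit Types (f df : R -> R) (a t d h k : R).

Lemma cvg_dnbhs_shift h t : s + h @[s --> t^'] --> (t + h)^'.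
Proof.
have c : s + h @[s --> t] --> t + h.
  by apply: cvgD; [exact: cvg_id|exact: cvg_cst].
move=> P Pth; have := c _ Pth; rewrite /= !nbhs_simpl /=.
rewrite /dnbhs /within /=; apply: filterS => s Ps st.
by apply: Ps; apply: contraNneq st => /addIr ->.
Qed.

Lemma is_derive_diffquot f t d :
  (f s - f t) / (s - t) @[s --> t^'] --> d -> is_derive t 1 f d.
Proof.
move=> fd.
have H : h^-1 *: (f (h *: 1 + t) - f t) @[h --> 0^'] --> d.
  have := @cvg_dnbhs_shift t 0; rewrite add0r => c.
  apply: cvg_trans (cvg_comp _ _ c fd).
  apply: near_eq_cvg; near=> h => /=.
  by rewrite addrK /GRing.scale /= mulr1 mulrC.
have dv : derivable f t 1 by apply: (cvgP _ H).
apply: (DeriveDef dv); exact: cvg_lim H.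
Unshelve. all: by end_near. Qed.

Lemma is_derive_continuous f t d : is_derive t 1 f d -> {for t, continuous f}.
Proof.
move=> fd; apply: differentiable_continuous; apply/derivable1_diffP.
exact: ex_derive.
Qed.

Lemma is_derive_ext f g t d e :
  is_derive t 1 f d -> f =1 g -> d = e -> is_derive t 1 g e.
Proof. by move=> + /funext <- <-. Qed.

Lemma MVT_derive f df a b : a <= b ->
  (forall s, a <= s <= b -> is_derive s 1 f (df s)) ->
  exists2 c, a <= c <= b & f b - f a = df c * (b - a).
Proof.
move=> ab fdf.
have cf : {within `[a, b], continuous f}.
  apply: continuous_in_subspaceT => x; rewrite inE /= in_itv /= => xab.
  exact: is_derive_continuous (fdf _ xab).
have fdo x : x \in `]a, b[ -> is_derive x 1 f (df x).
  by rewrite in_itv /= => /andP[? ?]; apply: fdf; rewrite !ltW.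
by have [c] := MVT_segment ab fdo cf; rewrite in_itv /=; exists c.
Qed.

Lemma MVT_ball f df t d k :
  (forall s, `|s - t| < d -> is_derive s 1 f (df s)) -> `|k| < d ->
  exists2 c, `|c - t| <= `|k| & f (t + k) - f t = df c * k.
Proof.
move=> fdf kd; have [k0|k0] := leP 0 k.
- have [||c /andP[? ?] ->] := @MVT_derive f df t (t + k); rewrite ?lerDl//.
    move=> s /andP[? ?]; apply: fdf; apply: le_lt_trans kd.
    by rewrite (ger0_norm k0) ler_norml; lra.
  exists c; last by congr (_ * _); ring.
  by rewrite (ger0_norm k0) ler_norml; lra.
- have [||c /andP[? ?] e] := @MVT_derive f df (t + k) t; rewrite ?gerDl ?ltW//.
    move=> s /andP[? ?]; apply: fdf; apply: le_lt_trans kd.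
    by rewrite (ltr0_norm k0) ler_norml; lra.
  exists c; last by rewrite -opprB e; ring.
  by rewrite (ltr0_norm k0) ler_norml; lra.
Qed.

End real_calculus.

Section halfline_calculus.
Context {R : realType}.
Implicit Types (f g : R -> R) (a t : R).
Local Notation leb := (@lebesgue_measure R).

(** The convergent difference quotient is bounded near [t] by |l| + 1, l being its limit, so
    [f s - f t] is O(s - t). *)
Lemma hl_C1_continuous f : hl_C1 f -> {within `[0, +oo[, continuous f}.
Proof.
move=> [cvgq _]; apply/subspace_continuousP => t;
  rewrite /= in_itv /= andbT => t0.
have /cvg_ex[l fl] := cvgq _ t0.
rewrite /hl_dnbhs in fl.
have FF : Filter (within `[0, +oo[ t^') by exact: within_filter.
have near1 := @cvgr_distC_lt _ _ _ _ FF _ _ fl _ ltr01.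
have FW : Filter (within `[0, +oo[ (nbhs t)) by exact: within_filter.
apply/(@cvgrPdistC_le _ _ _ _ FW) => e e0.
have L0 : 0 < `|l| + 1 by rewrite ltr_pwDr.
have : \forall s \near t, 0 <= s -> s != t ->
    `|hl_diffquot f t s - l| < 1.
  have : nbhs t [set s | s != t -> [set` `[0, +oo[] s ->
      `|hl_diffquot f t s - l| < 1] by exact: near1.
  apply: filterS => s H s0 st; apply: H => //.
  by rewrite /= in_itv /= andbT.
move=> near2;
  suff : \forall s \near t, [set` `[0, +oo[] s -> `|f s - f t| <= e by [].
near=> s; rewrite /= in_itv /= andbT => s0.
have [->|st] := eqVneq s t; first by rewrite subrr normr0 ltW.
have q1 : `|hl_diffquot f t s - l| < 1.
  by move: s0 st; near: s.
have ql : `|hl_diffquot f t s| <= `|l| + 1.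
  rewrite -[X in `|X|](subrK l) (le_trans (ler_normD _ _))// addrC.
  by rewrite lerD2l ltW.
have -> : f s - f t = hl_diffquot f t s * (s - t).
  by rewrite /hl_diffquot divfK// subr_eq0.
rewrite normrM (le_trans (ler_wpM2r _ ql))//.
rewrite mulrC -ler_pdivlMr// distrC; apply: ltW; near: s.
by apply: nbhsx_ballx; rewrite divr_gt0.
Unshelve. all: by end_near. Qed.

Lemma within_halflineS f a c : a <= c ->
  {within `[a, +oo[, continuous f} -> {within `[c, +oo[, continuous f}.
Proof.
move=> ac; apply: continuous_subspaceW => x /=; rewrite !in_itv /= !andbT.
exact: le_trans.
Qed.

Lemma within_halfline_integrable f a t : {within `[a, +oo[, continuous f} ->
  leb.-integrable `[a, t] (EFin \o f).
Proof.
move=> cf; apply: continuous_compact_integrable; first exact: segment_compact.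
apply: continuous_subspaceW cf => x /=; rewrite !in_itv /= andbT.
by case/andP.
Qed.

Lemma is_derive_primitive f a t : {within `[a, +oo[, continuous f} -> a < t ->
  is_derive t 1 (fun x => \int[leb]_(s in `[a, x]) f s) (f t).
Proof.
move=> cf at_; have tt1 : t < t + 1 by rewrite ltrDl.
have ct : {for t, continuous f}.
  have [H _] := (continuous_within_itvcyP a f).1 cf.
  by apply: H; rewrite in_itv /= andbT.
have [dF F't] := continuous_FTC1_closed tt1
  (within_halfline_integrable (t + 1) cf) at_ ct.
by apply: (DeriveDef dF); rewrite -derive1E; exact: F't.
Qed.

Lemma antiderivative f a : (forall t, a <= t -> {for t, continuous f}) ->
  exists F : R -> R, forall t, a < t -> is_derive t 1 F (f t).
Proof.
move=> cf; exists (fun x => \int[leb]_(s in `[a, x]) f s) => t.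
apply: is_derive_primitive; apply: continuous_in_subspaceT => x.
by rewrite inE /= in_itv /= andbT => /cf.
Qed.

Lemma cvg_primitive f a : {within `[a, +oo[, continuous f} ->
  \int[leb]_(s in `[a, x]) f s @[x --> a^'+] --> \int[leb]_(s in `[a, a]) f s.
Proof.
move=> cf; have aa1 : a < a + 1 by rewrite ltrDl.
have := parameterized_integral_continuous (ltW aa1)
  (within_halfline_integrable (a + 1) cf).
by move=> /(continuous_within_itvP _ aa1)[_ + _].
Qed.

Lemma primitive_start f a : \int[leb]_(s in `[a, a]) f s = 0.
Proof. by rewrite set_itv1 Rintegral_set1. Qed.

(** Finiteness of the integral over the half-line matters for the statement: [fine] would send an
    infinite value to 0. *)
Lemma primitive_le_integral f a t : {within `[a, +oo[, continuous f} ->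
  (forall s, a <= s -> 0 <= f s) ->
  (\int[leb]_(s in `[a, +oo[) (f s)%:E < +oo)%E ->
  \int[leb]_(s in `[a, t]) f s <= fine (\int[leb]_(s in `[a, +oo[) (f s)%:E).
Proof.
move=> cf f0 fy.
have mf : measurable_fun `[a, +oo[ (EFin \o f).
  by apply/measurable_EFinP; exact: subspace_continuous_measurable_fun.
have sub : `[a, t] `<=` `[a, +oo[.
  by move=> x /=; rewrite !in_itv /= andbT => /andP[].
have p0 (D : set R) : D `<=` `[a, +oo[ -> (0 <= \int[leb]_(s in D) (f s)%:E)%E.
  move=> Da; apply: integral_ge0 => s /Da /=; rewrite in_itv /= andbT lee_fin.
  exact: f0.
have le : (\int[leb]_(s in `[a, t]) (f s)%:E <=
    \int[leb]_(s in `[a, +oo[) (f s)%:E)%E.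
  apply: ge0_subset_integral => //.
  by move=> s; rewrite /= in_itv /= andbT lee_fin; exact: f0.
apply: fine_le => //.
- by rewrite ge0_fin_numE ?p0//; exact: le_lt_trans le fy.
- by rewrite ge0_fin_numE ?p0.
Qed.

End halfline_calculus.

(** * Monotonicity and comparison for differential inequalities *)

Section comparison.
Context {R : realType}.
Implicit Types (f df : R -> R) (a t A K M : R).

Lemma derive_le0_nincr f df a : (forall t, a < t -> is_derive t 1 f (df t)) ->
  (forall t, a < t -> df t <= 0) -> f s @[s --> a^'+] --> f a ->
  forall t, a <= t -> f t <= f a.
Proof.
move=> fdf df0 fa t at_.
have dP (x : R) : x \in `]a, +oo[ -> is_derive x 1 f (df x).
  by rewrite in_itv /= andbT => /fdf.
apply: (@ler0_derive1_nincry _ f a) => // [x /dP|x /[dup] xa /dP dfx|].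
- by move=> dfx; exact: ex_derive.
- rewrite derive1E (@derive_val _ _ _ _ _ _ _ dfx); apply: df0.
  by move: xa; rewrite in_itv /= andbT.
- apply/continuous_within_itvcyP; split => // x /dP.
  exact: is_derive_continuous.
Qed.

(** In all four sign cases the remainder of the first order expansion is at most (y - x)^2, so the
    kink of the positive part disappears after squaring. *)
Lemma is_derive_pos_part_sqr (x : R) :
  is_derive x 1 (fun y => Num.max y 0 ^+ 2) (2 * Num.max x 0).
Proof.
apply: is_derive_diffquot; apply/cvgrPdistC_le => e e0; near=> y.
have yx : y - x != 0 by rewrite subr_eq0; near: y; exact: nbhs_dnbhs_neq.
have ye : `|y - x| < e.
  by rewrite distrC; near: y; apply: nbhs_dnbhs; exact: nbhsx_ballx.
apply: le_trans (ltW ye).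
rewrite -(ler_pM2r (_ : 0 < `|y - x|)) ?normr_gt0// -normrM mulrBl divfK//.
rewrite -normrM -expr2 [leRHS]ger0_norm ?sqr_ge0//.
by rewrite ler_norml; case: (leP y 0) => y0; case: (leP x 0) => x0; nra.
Unshelve. all: by end_near. Qed.

(* Along the flow the larger of P and Q does not grow; the sum of the squares
   of the excesses over A is a differentiable substitute for their maximum. *)
Lemma cooperative_comparison (P Q p q g h : R -> R) A K :
  (forall t, 0 < t -> is_derive t 1 P (p t)) ->
  (forall t, 0 < t -> is_derive t 1 Q (q t)) ->
  P s @[s --> 0^'+] --> P 0 -> Q s @[s --> 0^'+] --> Q 0 ->
  (forall t, 0 < t -> p t <= g t * (Q t - P t)) ->
  (forall t, 0 < t -> q t <= h t * (P t - Q t)) ->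
  (forall t, 0 < t -> 0 <= g t <= K) -> (forall t, 0 < t -> 0 <= h t <= K) ->
  P 0 <= A -> Q 0 <= A -> forall t, 0 <= t -> P t <= A /\ Q t <= A.
Proof.
move=> dP dQ cP cQ pg qh gK hK P0 Q0 t t0.
pose pp (y : R) : R := Num.max y 0 ^+ 2.
(* The exponential absorbs the growth of the sum of squares, whose derivative is at most [K] times
   the sum itself. *)
pose phi s := (Num.max (P s - A) 0 ^+ 2 + Num.max (Q s - A) 0 ^+ 2)
  * expR (- K * s).
have dphi (s : R) : 0 < s -> is_derive s 1 phi
    ((2 * Num.max (P s - A) 0 * p s + 2 * Num.max (Q s - A) 0 * q s
      - K * (Num.max (P s - A) 0 ^+ 2 + Num.max (Q s - A) 0 ^+ 2))
     * expR (- K * s)).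
  move=> s0.
  have d1 := @is_derive1_comp _ pp (P - cst A) _ _ _
    (is_derive_pos_part_sqr (P s - A))
    (is_deriveB (dP _ s0) (is_derive_cst A s 1)).
  have d2 := @is_derive1_comp _ pp (Q - cst A) _ _ _
    (is_derive_pos_part_sqr (Q s - A))
    (is_deriveB (dQ _ s0) (is_derive_cst A s 1)).
  have d3 := @is_derive1_comp _ expR (- K \*: id) _ _ _
    (is_derive_expR (- K * s))
    (is_deriveZ (- K) (is_derive_id s 1)).
  apply: (is_derive_ext (is_deriveM (is_deriveD d1 d2) d3)) => //.
  by rewrite /GRing.scale /= !fctE /= !subr0 /GRing.scale /= /pp; ring.
have cpp (f : R -> R) : f s @[s --> 0^'+] --> f 0 ->
    pp (f s - A) @[s --> 0^'+] --> pp (f 0 - A).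
  move=> cf; have c : f s - A @[s --> 0^'+] --> f 0 - A.
    by apply: cvgB => //; exact: cvg_cst.
  exact: (cvg_comp _ _ c (is_derive_continuous (is_derive_pos_part_sqr _))).
have : phi t <= phi 0.
  apply: derive_le0_nincr dphi _ _ _ t0 => [s s0|].
    rewrite pmulr_lle0 ?expR_gt0//.
    have := pg _ s0; have := qh _ s0.
    have /andP[g0 gK'] := gK _ s0; have /andP[h0 hK'] := hK _ s0.
    have pos (x : R) : 0 <= Num.max x 0 /\ x <= Num.max x 0 /\
        Num.max x 0 * x = Num.max x 0 ^+ 2.
      by case: (leP x 0) => x0; rewrite ?mul0r ?expr0n /= ?expr2; split => //;
        lra.
    have [] := pos (P s - A); have [] := pos (Q s - A).
    set a := Num.max _ _; set c := Num.max _ _ => a0 [aQ aE] c0 [cP' cE] qs ps.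
    have H1 : c * p s <= g s * (a * c - c ^+ 2).
      apply: (le_trans (ler_wpM2l c0 ps)); rewrite mulrCA ler_wpM2l//.
      have := ler_wpM2l c0 aQ; lra.
    have H2 : a * q s <= h s * (a * c - a ^+ 2).
      apply: (le_trans (ler_wpM2l a0 qs)); rewrite mulrCA ler_wpM2l//.
      have := ler_wpM2l a0 cP'; lra.
    (* By 2 a c <= a^2 + c^2, twice [H1] is bounded by [g s] a^2 and twice [H2] by [h s] c^2;
       together at most [K] (a^2 + c^2). *)
    have := mulr_ge0 g0 (sqr_ge0 (a - c));
      have := mulr_ge0 h0 (sqr_ge0 (a - c)).
    have := mulr_ge0 g0 (sqr_ge0 c); have := mulr_ge0 h0 (sqr_ge0 a).
    have := ler_wpM2r (sqr_ge0 a) gK'; have := ler_wpM2r (sqr_ge0 c) hK'.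
    lra.
  apply: cvgM; first by apply: cvgD; exact: cpp.
  apply: cvg_at_right_filter; have c : - K * s @[s --> 0] --> - K * 0.
    by apply: cvgM; [exact: cvg_cst|exact: cvg_id].
  exact: (cvg_comp _ _ c (@continuous_expR _ _)).
rewrite /phi mulr0 expR0 mulr1.
rewrite (max_r (_ : P 0 - A <= 0)) ?subr_le0//
  (max_r (_ : Q 0 - A <= 0)) ?subr_le0//.
rewrite expr0n addr0 pmulr_lle0 ?expR_gt0// => H.
split; rewrite -subr_le0; apply: contraTT H; rewrite -!ltNge => H.
- by rewrite ltr_pwDl ?sqr_ge0// exprn_gt0// lt_max H.
- by rewrite ltr_wpDl ?sqr_ge0// exprn_gt0// lt_max H.
Qed.

End comparison.

(** * The weighted energy inequality *)

Section energy_inequality.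
Context {R : realType}.

Implicit Types t : R.

Lemma scaleRE (a c : R) : a *: (c : R^o) = a * c.
Proof. by []. Qed.

Lemma is_derive_inv1D t : 0 < t ->
  is_derive t 1 (fun s : R => (1 + s)^-1) (- (1 + t)^-1 ^+ 2).
Proof.
move=> t0; have t1 : 1 + t != 0 by rewrite gt_eqF//; lra.
have d1 := is_deriveD (is_derive_cst (1 : R) t 1) (is_derive_id t 1).
have := @is_deriveV _ (cst 1 + id) t _ 1 t1 d1.
move=> d2; apply: (is_derive_ext d2) => //.
by rewrite /GRing.scale /= !fctE /= add0r mulr1 exprVn.
Qed.

Lemma is_derive_expR_ln1D (c t : R) : 0 < t ->
  is_derive t 1 (fun s => expR (c * ln (1 + s)))
    (c * (1 + t)^-1 * expR (c * ln (1 + t))).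
Proof.
move=> t0; have t1 : 0 < 1 + t by lra.
have d1 := is_deriveD (is_derive_cst (1 : R) t 1) (is_derive_id t 1).
have d2 := @is_derive1_comp _ (@ln R) (cst 1 + id) t _ _ (is_derive1_ln t1) d1.
have d3 := is_deriveZ c d2.
have d4 := @is_derive1_comp _ expR _ t _ _ (is_derive_expR _) d3.
apply: (is_derive_ext d4) => //.
by rewrite /GRing.scale /= /GRing.scale /= !fctE /=; ring.
Qed.

Lemma cvg_inv1D : (1 + s)^-1 @[s --> (0 : R)^'+] --> ((1 + 0)^-1 : R).
Proof.
apply: cvgV; first by rewrite addr0 oner_eq0.
by apply: cvgD; [exact: cvg_cst|exact/cvg_at_right_filter/cvg_id].
Qed.

Lemma cvg_ln1D : ln (1 + s) @[s --> (0 : R)^'+] --> (ln (1 + 0) : R).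
Proof.
have c1 : 1 + s @[s --> (0 : R)^'+] --> 1 + (0 : R).
  by apply: cvgD; [exact: cvg_cst|exact/cvg_at_right_filter/cvg_id].
have p : 0 < 1 + 0 :> R by rewrite addr0.
exact: (cvg_comp _ _ c1 (continuous_ln p)).
Qed.

Lemma cvg_expR_ln1D (c : R) :
  expR (c * ln (1 + s)) @[s --> (0 : R)^'+] --> expR (c * ln (1 + 0)).
Proof.
have c3 : c * ln (1 + s) @[s --> (0 : R)^'+] --> c * ln (1 + 0).
  by apply: cvgM; [exact: cvg_cst|exact: cvg_ln1D].
exact: (cvg_comp _ _ c3 (@continuous_expR _ _)).
Qed.

Variables (b0 m0 M K : R) (b m g Gam y z X G : R -> R).
Let mu0 := m0 - b0 ^+ 2 / 4 + b0 / 2.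
Let q (t : R) := (1 + t)^-1.
Let w (t : R) := expR (b0 * ln (1 + t)).
Let beta t := b t - b0 * q t.
Let rho t := m t - m0 * q t ^+ 2.
Let delta t := rho t - beta t * (b0 / 2) * q t.
Hypothesis mu0_ge0 : 0 <= mu0.
Hypothesis g_ge : forall t, 0 < t ->
  2 * `|beta t| + (1 + t) * `|delta t| <= g t <= K.
Hypotheses (dGam : forall t, 0 < t -> is_derive t 1 Gam (g t))
  (cGam : Gam s @[s --> 0^'+] --> Gam 0) (Gam0 : Gam 0 = 0)
  (GamM : forall t, 0 <= t -> Gam t <= M).
Hypotheses
  (dy : forall t, 0 < t -> is_derive t 1 y (2 * z t))
  (dz : forall t, 0 < t -> is_derive t 1 z (X t - G t - b t * z t - m t * y t))
  (de : forall t, 0 < t -> is_derive t 1 (fun s => X s + G s)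
    (- 2 * (b t * X t + m t * z t))).
Hypotheses (cy : y s @[s --> 0^'+] --> y 0) (cz : z s @[s --> 0^'+] --> z 0)
  (ce : X s + G s @[s --> 0^'+] --> X 0 + G 0).
Hypotheses (y_ge0 : forall t, 0 <= t -> 0 <= y t)
  (X_ge0 : forall t, 0 <= t -> 0 <= X t)
  (G_ge0 : forall t, 0 <= t -> 0 <= G t)
  (gram : forall t, 0 <= t -> z t ^+ 2 <= X t * y t).

(* With v = (1+t)^(b0/2) u, the quantities below are |v_t|^2, (v, v_t),
   the energy |v_t|^2 + |grad v|^2 + mu0 |v|^2 / (1+t)^2 and
   |v|^2 / (1+t)^2, the first two without the factor w = (1+t)^b0. *)
Let V t := X t + b0 * q t * z t + b0 ^+ 2 / 4 * q t ^+ 2 * y t.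
Let zv t := z t + b0 / 2 * q t * y t.
Let E t := w t * (X t + G t + b0 * q t * z t + (m0 + b0 / 2) * q t ^+ 2 * y t).
Let Z t := w t * (q t ^+ 2 * y t).

Let E' t := w t * (- 2 * beta t * V t - 2 * delta t * zv t
  - 2 * mu0 * q t ^+ 3 * y t).
Let Z' t := w t * (2 * q t ^+ 2 * zv t - 2 * q t ^+ 3 * y t).

(** This is the energy identity of the equation for v, obtained by algebra from the equations for
    [y], [z] and [X + G]. The last term of [E'] comes from the decay of mu0 / (1 + t)^2. *)
Let dE t : 0 < t -> is_derive t 1 E (E' t).
Proof.
move=> t0; have dq := is_derive_inv1D t0; have dw := is_derive_expR_ln1D b0 t0.
have d1 := is_deriveM dq (dz t0).
have d2 := is_deriveM (is_deriveM dq dq) (dy t0).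
have d3 := is_deriveM dw (is_deriveD (is_deriveD (de t0) (is_deriveZ b0 d1))
  (is_deriveZ (m0 + b0 / 2) d2)).
apply: (is_derive_ext d3) => [s|].
  by rewrite /E !fctE /= !scaleRE -/(w s) -/(q s); ring.
rewrite !fctE /= !scaleRE -/(w t) -/(q t).
by rewrite /E' /V /zv /delta /beta /rho /mu0; field.
Qed.

Let dZ t : 0 < t -> is_derive t 1 Z (Z' t).
Proof.
move=> t0; have dq := is_derive_inv1D t0; have dw := is_derive_expR_ln1D b0 t0.
have d2 := is_deriveM (is_deriveM dq dq) (dy t0).
apply: (is_derive_ext (is_deriveM dw d2)) => [s|].
  by rewrite /Z !fctE -/(w s) -/(q s); ring.
rewrite !fctE /= !scaleRE -/(w t) -/(q t).
by rewrite /Z' /zv; field.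
Qed.

(** A positive semidefinite 2 by 2 matrix with diagonal [a], [d] and off-diagonal entry [x],
    evaluated at (1, c). Completing the square requires multiplying by [d]; when [d] is 0, [x] is 0
    too. *)
Let gram_quad (x c : R) (a d : R) : 0 <= a -> 0 <= d -> x ^+ 2 <= a * d ->
  0 <= a + 2 * c * x + c ^+ 2 * d.
Proof.
move=> a0; rewrite le_eqVlt => /predU1P[<-|d0] xad.
  have x0 : x ^+ 2 = 0 by apply/eqP; rewrite eq_le sqr_ge0 andbT; lra.
  by move/eqP: x0; rewrite sqrf_eq0 => /eqP ->; lra.
rewrite -(pmulr_rge0 _ d0).
rewrite [leRHS](_ : _ = (a * d - x ^+ 2) + (x + c * d) ^+ 2); last by ring.
by rewrite addr_ge0 ?sqr_ge0// subr_ge0.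
Qed.

Let q_gt0 t : 0 <= t -> 0 < q t.
Proof. by move=> t0; rewrite invr_gt0; lra. Qed.

Let w_gt0 t : 0 < w t.
Proof. exact: expR_gt0. Qed.

Let V_ge0 t : 0 <= t -> 0 <= V t.
Proof.
move=> t0; have := gram_quad (b0 * q t / 2) (X_ge0 t0) (y_ge0 t0) (gram t0).
by rewrite /V; lra.
Qed.

(** The passage from (u, u_t) to (v, v_t) is unimodular up to the factor [w], so the Gram
    determinant is unchanged and Cauchy-Schwarz holds for [zv] as well. The choices c = q and c = -q
    in [gram_quad] then give both signs. *)
Let q_zv_le t : 0 <= t -> `|2 * q t * zv t| <= V t + q t ^+ 2 * y t.
Proof.
move=> t0; have zvVy : zv t ^+ 2 <= V t * y t.
  rewrite -subr_ge0 (_ : _ - _ = X t * y t - z t ^+ 2).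
    by rewrite subr_ge0 gram.
  by rewrite /zv /V; field.
have := gram_quad (q t) (V_ge0 t0) (y_ge0 t0) zvVy.
have := gram_quad (- q t) (V_ge0 t0) (y_ge0 t0) zvVy.
by rewrite ler_norml sqrrN; lra.
Qed.

(** [E] is defined through the sum [X + G], whose derivative is what is known; this form exhibits
    its positivity, by m0 + b0 / 2 = mu0 + b0^2 / 4. *)
Let EE t : E t = w t * (V t + G t + mu0 * (q t ^+ 2 * y t)).
Proof. by rewrite /E /V /mu0; field. Qed.

Let qy_ge0 t : 0 <= t -> 0 <= q t ^+ 2 * y t.
Proof. by move=> t0; rewrite mulr_ge0 ?sqr_ge0 ?y_ge0. Qed.

Let le_energy t : 0 <= t -> [/\ w t * V t <= E t, w t * G t <= E t & 0 <= Z t].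
Proof.
move=> t0; rewrite EE !(ler_pM2l (w_gt0 t)).
have := V_ge0 t0; have := G_ge0 t0; have := mulr_ge0 mu0_ge0 (qy_ge0 t0).
have Z0 : 0 <= Z t by apply: mulr_ge0; [exact: ltW|exact: qy_ge0].
by split => //; lra.
Qed.

(** The term with mu0 in [E'] has a favourable sign and is dropped. Bounding [zv] costs a multiple
    of q^2 y without the factor mu0, which only [Z] can pay for. *)
Let E'_le t : 0 < t -> E' t <= g t * (E t + Z t).
Proof.
move=> t0; have t0' := ltW t0.
rewrite (_ : _ * (_ + _) =
  w t * (g t * (V t + G t + mu0 * (q t ^+ 2 * y t) + q t ^+ 2 * y t)));
    last first.
  by rewrite EE /Z; ring.
rewrite (ler_pM2l (w_gt0 t)).
have := V_ge0 t0'; have := G_ge0 t0'; have := qy_ge0 t0'; have := q_zv_le t0'.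
have qt : q t * (1 + t) = 1 by rewrite mulVf// gt_eqF//; lra.
have q0 := q_gt0 t0'.
have /andP[gt _] := g_ge t0.
set v := V t; set Gt := G t; set yt := q t ^+ 2 * y t => zle y0 G0 v0.
have H1 : - beta t * v <= `|beta t| * v
  by rewrite ler_wpM2r// ler_normr lexx orbT.
have H2 : - 2 * delta t * zv t <= (1 + t) * `|delta t| * (v + yt).
  apply: (le_trans (ler_norm _)).
  (* Inserting q (1 + t) = 1 pairs [delta] with the weight 1 + t, under which it is integrable. *)
  have -> : -2 * delta t * zv t = - (1 + t) * delta t * (2 * q t * zv t).
    rewrite [RHS](_ : _ = -2 * delta t * zv t * (q t * (1 + t))); last by ring.
    by rewrite qt mulr1.
  rewrite normrM ler_pM//.
  by rewrite normrM normrN (@ger0_norm _ (1 + t))//; lra.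
have mu0y := mulr_ge0 mu0_ge0 y0.
have H3 : (2 * `|beta t| + (1 + t) * `|delta t|) * (v + yt) <=
    g t * (v + Gt + mu0 * yt + yt).
  apply: ler_pM => //; [|lra|lra].
  by rewrite addr_ge0 ?mulr_ge0//; lra.
have H4 := mulr_ge0 (normr_ge0 (beta t)) y0.
have H5 : 0 <= mu0 * q t ^+ 3 * y t.
  by rewrite -mulrA exprS -mulrA mulrCA mulr_ge0// ltW.
have H6 : 0 <= (1 + t) * `|delta t| * (v + yt).
  by rewrite !mulr_ge0//; lra.
lra.
Qed.

(** Differentiating (1 + t)^-2 yields -2 q^3 y; half of it pays for the mixed term through
    [q_zv_le], and the other half remains as -q Z. *)
Let Z'_le t : 0 < t -> Z' t <= q t * (E t - Z t).
Proof.
move=> t0; have t0' := ltW t0.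
rewrite (_ : q t * _ = w t * (q t * (V t + G t + mu0 * (q t ^+ 2 * y t)
  - q t ^+ 2 * y t))); last by rewrite EE /Z; ring.
rewrite (ler_pM2l (w_gt0 t)).
have G0 := G_ge0 t0'; have y0 := mulr_ge0 mu0_ge0 (qy_ge0 t0').
have q0 := q_gt0 t0'; have := q_zv_le t0'.
move=> /(le_trans (ler_norm _)) /(ler_wpM2l (ltW q0)) H.
have := mulr_ge0 (ltW q0) G0; have := mulr_ge0 (ltW q0) y0; lra.
Qed.

(** In [C], the innermost factor bounds E and Z at time 0, [expR (2 * M)] undoes the exponential
    weight, and [2 + b0 ^+ 2 / 2] is the price of returning from v_t to u_t. *)
Lemma energy_inequality t : 0 <= t ->
  let C := (2 + b0 ^+ 2 / 2) * (expR (2 * M) *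
    ((1 + `|b0| + `|m0 + b0 / 2|) * (X 0 + G 0 + y 0))) in
  [/\ w t * X t <= C, w t * G t <= C & w t * (q t ^+ 2 * y t) <= C].
Proof.
move=> t0; set A := (1 + _ + _) * _.
(* The exponent is -2 Gam rather than -Gam so that g (E + Z) - 2 g E becomes g (Z - E), the form
   needed for the comparison. *)
pose P s := E s * expR (-2 * Gam s); pose Q s := Z s * expR (-2 * Gam s).
have dexp (s : R) : 0 < s -> is_derive s 1 (fun s => expR (-2 * Gam s))
    (expR (-2 * Gam s) * (-2 * g s)).
  move=> s0; apply: (@is_derive1_comp _ expR (-2 \*: Gam)).
  exact: is_deriveZ (dGam s0).
have dP (s : R) :
  0 < s -> is_derive s 1 P ((E' s - 2 * g s * E s) * expR (-2 * Gam s)).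
  move=> s0; apply: (is_derive_ext (is_deriveM (dE s0) (dexp _ s0))) => //.
  by rewrite !scaleRE; ring.
have dQ (s : R) :
  0 < s -> is_derive s 1 Q ((Z' s - 2 * g s * Z s) * expR (-2 * Gam s)).
  move=> s0; apply: (is_derive_ext (is_deriveM (dZ s0) (dexp _ s0))) => //.
  by rewrite !scaleRE; ring.
have y00 := y_ge0 (lexx 0); have X00 := X_ge0 (lexx 0);
  have G00 := G_ge0 (lexx 0).
have q0 : q 0 = 1 by rewrite /q addr0 invr1.
have w0 : w 0 = 1 by rewrite /w addr0 ln1 mulr0 expR0.
have P0 : P 0 <= A.
  rewrite /P Gam0 mulr0 expR0 mulr1 /E q0 w0 /A.
  have := gram_quad 1 X00 y00 (gram (lexx 0)).
  have := gram_quad (-1) X00 y00 (gram (lexx 0)).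
  rewrite !(expr1n, sqrrN) => z1 z2.
  have : b0 * z 0 <= `|b0| * (X 0 + y 0).
    rewrite (le_trans (ler_norm _))// normrM ler_wpM2l// ler_norml; lra.
  have := ler_wpM2r y00 (ler_norm (m0 + b0 / 2)).
  have := mulr_ge0 (normr_ge0 b0) G00.
  have := mulr_ge0 (normr_ge0 (m0 + b0 / 2)) (addr_ge0 X00 G00).
  lra.
have Q0 : Q 0 <= A.
  rewrite /Q Gam0 mulr0 expR0 mulr1 /Z q0 w0 /A.
  have := mulr_ge0 (addr_ge0 (normr_ge0 b0) (normr_ge0 (m0 + b0 / 2)))
    (addr_ge0 (addr_ge0 X00 G00) y00).
  rewrite expr1n; lra.
have cexp : expR (-2 * Gam s) @[s --> 0^'+] --> expR (-2 * Gam 0).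
  have c : -2 * Gam s @[s --> 0^'+] --> -2 * Gam 0.
    by apply: cvgM; [exact: cvg_cst|exact: cGam].
  exact: (cvg_comp _ _ c (@continuous_expR _ _)).
have cq2y : q s ^+ 2 * y s @[s --> 0^'+] --> q 0 ^+ 2 * y 0.
  by apply: cvgM => //; apply: cvgM; exact: cvg_inv1D.
have cP : P s @[s --> 0^'+] --> P 0.
  apply: cvgM => //; apply: cvgM; first exact: cvg_expR_ln1D.
  apply: cvgD; last first.
    under eq_cvg do rewrite -mulrA.
    by rewrite -mulrA; apply: cvgM => //; exact: cvg_cst.
  apply: cvgD => //; apply: cvgM => //; apply: cvgM; first exact: cvg_cst.
  exact: cvg_inv1D.
have cQ : Q s @[s --> 0^'+] --> Q 0.
  by apply: cvgM => //; apply: cvgM => //; exact: cvg_expR_ln1D.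
(* The rate [g] is at most [K] and the rate [q] at most 1; [K + 1] serves for both. *)
have [] := @cooperative_comparison _ P Q _ _ g q A
  (K + 1) dP dQ cP cQ _ _ _ _ P0 Q0 t t0.
- move=> s s0; rewrite [leRHS](_ : _ = g s * (Z s - E s) * expR (-2 * Gam s)).
    rewrite ler_pM2r ?expR_gt0//.
    by have := E'_le s0; lra.
  by rewrite /P /Q; ring.
- move=> s s0; rewrite [leRHS](_ : _ = q s * (E s - Z s) * expR (-2 * Gam s)).
  2: by rewrite /P /Q; ring.
  rewrite ler_pM2r ?expR_gt0//.
  have [_ _ Z0] := le_energy (ltW s0); have /andP[gs _] := g_ge s0.
  have : 0 <= g s.
    by apply: le_trans gs; rewrite addr_ge0// mulr_ge0//; lra.
  by move=> /mulr_ge0 /(_ Z0); have := Z'_le s0; lra.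
- move=> s s0; have /andP[gs gK] := g_ge s0; apply/andP; split; last lra.
  by apply: le_trans gs; rewrite addr_ge0// mulr_ge0//; lra.
- move=> s s0; have /andP[gs gK] := g_ge s0; apply/andP; split.
    exact/ltW/q_gt0/ltW.
  have K0 : 0 <= K.
    apply: le_trans gK; apply: le_trans gs.
    by rewrite addr_ge0// mulr_ge0//; lra.
  by apply: (@le_trans _ _ 1); [rewrite invf_le1; lra|lra].
have A0 : 0 <= A by rewrite mulr_ge0// !addr_ge0.
have unexp x : x * expR (-2 * Gam t) <= A -> x <= expR (2 * M) * A.
  rewrite mulNr expRN ler_pdivrMr ?expR_gt0// mulrC => /le_trans; apply.
  by rewrite ler_wpM2r// ler_expR ler_pM2l// GamM.
move=> /unexp EA /unexp ZA /=.
have [wV wG Z0] := le_energy t0.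
have D0 : 0 <= expR (2 * M) * A by rewrite mulr_ge0// expR_ge0.
have b2 := sqr_ge0 b0.
have bD := mulr_ge0 b2 D0.
split; last 2 first.
- lra.
- by move: ZA; rewrite /Z; lra.
(* Up to the factor [w], this is |v_t - (b0 / 2) q v|^2 <= 2 |v_t|^2 + (b0^2 / 2) q^2 |v|^2. *)
have XV : X t <= 2 * V t + b0 ^+ 2 / 2 * (q t ^+ 2 * y t).
  have := gram_quad (b0 * q t) (X_ge0 t0) (y_ge0 t0) (gram t0).
  by rewrite /V; lra.
have := ler_wpM2l (ltW (w_gt0 t)) XV.
have := ler_wpM2l b2 ZA; rewrite /Z; lra.
Qed.

End energy_inequality.

(** * The coefficients *)

Section coefficients.
Context {R : realType}.
Local Notation leb := (@lebesgue_measure R).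
Implicit Types t s : R.
Variables (b m : R -> R) (B b0 m0 : R).
Hypotheses (cb : {within `[0, +oo[, continuous b})
  (cm : {within `[0, +oo[, continuous m}).
Hypotheses (b_le : forall t, 0 <= t -> `|b t| <= B * (1 + t)^-1)
  (m_le : forall t, 0 <= t -> `|m t| <= B * (1 + t)^-1 ^+ 2).
Hypothesis b_int : (\int[leb]_(t in `[1%R, +oo[)
  (`|t * b t - b0| / t)%:E < +oo)%E.
Hypothesis m_int : (\int[leb]_(t in `[1%R, +oo[)
  (`|t ^+ 2 * m t - m0| / t)%:E < +oo)%E.

Let q t := (1 + t)^-1.
Let beta t := b t - b0 * q t.
Let delta t := m t - m0 * q t ^+ 2 - beta t * (b0 / 2) * q t.
Let g t := 2 * `|beta t| + (1 + t) * `|delta t|.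
Let Gam t := \int[leb]_(s in `[0, t]) g s.
Let k1 t := `|t * b t - b0| / t.
Let k2 t := `|t ^+ 2 * m t - m0| / t.
Let c1 := 2 + `|b0| / 2.
Let c3 := c1 * `|b0| + B + `|m0|.
Let K := 2 * (B + `|b0|) + B + `|m0| + (B + `|b0|) * (`|b0| / 2).

Let B_ge0 : 0 <= B.
Proof. by have := b_le (lexx 0); rewrite addr0 invr1 mulr1;
  apply: le_trans. Qed.

Let q_bounds t : 0 <= t -> [/\ 0 < q t, q t <= 1 & (1 + t) * q t = 1].
Proof.
move=> t0; split; [by rewrite invr_gt0; lra|by rewrite invf_le1; lra|].
by rewrite mulfV// gt_eqF//; lra.
Qed.

Let cg : {within `[0, +oo[, continuous g}.
Proof.
apply/subspace_continuousP => t t_in.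
have t0 : 0 <= t by move: t_in; rewrite /= in_itv /= andbT.
have FW : Filter (within `[0, +oo[ (nbhs t)) by exact: within_filter.
have bt := (subspace_continuousP _ b).1 cb t t_in.
have mt := (subspace_continuousP _ m).1 cm t t_in.
have id_t : (fun s => 1 + s) @ within `[0, +oo[ (nbhs t) --> 1 + t.
  by apply: cvg_within_filter; apply: cvgD; [exact: cvg_cst|exact: cvg_id].
have qt : q @ within `[0, +oo[ (nbhs t) --> q t.
  by apply: cvgV => //; rewrite gt_eqF//; lra.
have betat : beta @ within `[0, +oo[ (nbhs t) --> beta t.
  by apply: cvgB => //; apply: cvgM => //; exact: cvg_cst.
have q2t : (fun s => m0 * q s ^+ 2) @ within `[0, +oo[ (nbhs t) -->
  m0 * q t ^+ 2.
  by apply: cvgM; [exact: cvg_cst|apply: cvgM].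
have deltat : delta @ within `[0, +oo[ (nbhs t) --> delta t.
  apply: cvgB; first exact: cvgB.
  by apply: cvgM => //; apply: cvgM => //; exact: cvg_cst.
apply: cvgD; first by apply: cvgM; [exact: cvg_cst|exact: cvg_norm].
by apply: cvgM => //; exact: cvg_norm.
Qed.

Let ck (f : R -> R) (c : R) (n : nat) : {within `[0, +oo[, continuous f} ->
  {within `[1, +oo[, continuous (fun t => `|t ^+ n * f t - c| / t)}.
Proof.
move=> cf; apply/subspace_continuousP => t t_in.
have t1 : 1 <= t by move: t_in; rewrite /= in_itv /= andbT.
have FW : Filter (within `[1, +oo[ (nbhs t)) by exact: within_filter.
have ft := (subspace_continuousP _ f).1 (within_halflineS ler01 cf) t t_in.
have id_t : id @ within `[1, +oo[ (nbhs t) --> t.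
  by apply: cvg_within_filter; exact: cvg_id.
apply: cvgM; last by apply: cvgV => //; rewrite gt_eqF//; lra.
apply: cvg_norm; apply: cvgB; last exact: cvg_cst.
apply: cvgM => //; apply: cvg_within_filter.
exact: exprn_continuous.
Qed.

Let abs_beta_le t : 0 <= t -> `|beta t| <= (B + `|b0|) * q t.
Proof.
move=> t0; have [q0 _ _] := q_bounds t0.
rewrite (le_trans (ler_normB _ _))// mulrDl lerD ?b_le//.
by rewrite normrM (ger0_norm (ltW q0)).
Qed.

Let g_bounds t : 0 <= t -> 2 * `|beta t| + (1 + t) * `|delta t| <= g t <= K.
Proof.
move=> t0; have [q0 q1 qt] := q_bounds t0; have bt := abs_beta_le t0.
rewrite lexx /= /g.
have H1 : `|delta t| <= ((B + `|m0|) + (B + `|b0|) * (`|b0| / 2)) * q t ^+ 2.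
  rewrite (le_trans (ler_normB _ _))// [leRHS]mulrDl lerD//.
    rewrite (le_trans (ler_normB _ _))// mulrDl lerD ?m_le//.
    by rewrite normrM normrX (ger0_norm (ltW q0)).
  rewrite !normrM (ger0_norm (ltW q0)) normfV (ger0_norm (ler0n _ _)).
  rewrite expr2 [leRHS]mulrA ler_pM2r// [leRHS]mulrAC.
  by rewrite ler_wpM2r// divr_ge0.
have H2 : (1 + t) * `|delta t| <= B + `|m0| + (B + `|b0|) * (`|b0| / 2).
  rewrite (le_trans (ler_wpM2l _ H1))//; first lra.
  rewrite mulrCA expr2 [X in _ * X]mulrA qt mul1r.
  rewrite ler_piMr// !addr_ge0// mulr_ge0// ?addr_ge0// divr_ge0//.
have H3 : `|beta t| <= B + `|b0|.
  by rewrite (le_trans bt)// ler_piMr// addr_ge0.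
by rewrite /K; lra.
Qed.

Let g_ge0 t : 0 <= t -> 0 <= g t.
Proof. by move=> t0; rewrite addr_ge0// mulr_ge0//; lra. Qed.

(** The integral conditions are centred at 1 / t while [beta] and [delta] are centred at 1 / (1 +
    t). Since 1 / t - 1 / (1 + t) = 1 / (t (1 + t)), the change costs O(t^-2), collected in [c3];
    [c1] counts how often |beta| occurs. *)
Let g_le t : 1 <= t -> g t <= c1 * k1 t + k2 t + c3 * t^-1 ^+ 2.
Proof.
move=> t1; have t0 : 0 < t by lra.
have [q0 q1 qt] := q_bounds (ltW t0).
have tV0 : 0 < t^-1 by rewrite invr_gt0.
have q_le : q t <= t^-1 by rewrite /q lef_pV2 ?posrE; lra.
have tq : t^-1 - q t = t^-1 * q t by rewrite /q; field; lra.
have qq : t^-1 * q t <= t^-1 ^+ 2 by rewrite expr2 ler_pM2l.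
have H1 : `|beta t| <= k1 t + `|b0| * t^-1 ^+ 2.
  have -> : beta t = (t * b t - b0) / t + b0 * (t^-1 * q t).
    by rewrite -tq /beta; field; lra.
  rewrite (le_trans (ler_normD _ _))// lerD//.
    by rewrite normrM (ger0_norm (ltW tV0)).
  by rewrite normrM ler_wpM2l// ger0_norm// ltW// mulr_gt0.
have H2 : (1 + t) * `|m t - m0 * q t ^+ 2| <=
    k2 t + (B + `|m0|) * t^-1 ^+ 2.
  rewrite -[X in X * _]ger0_norm; last lra.
  rewrite -normrM.
  have -> : (1 + t) * (m t - m0 * q t ^+ 2) =
      (t ^+ 2 * m t - m0) / t + m t + m0 * (t^-1 * q t).
    rewrite mulrBr expr2 [m0 * _]mulrCA !mulrA qt mul1r -mulrA -tq.
    by field; lra.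
  rewrite (le_trans (ler_normD _ _))// [in leRHS]mulrDl [leRHS]addrA lerD//;
    last first.
    by rewrite normrM ler_wpM2l// ger0_norm// ltW// mulr_gt0.
  rewrite (le_trans (ler_normD _ _))// lerD//.
    by rewrite normrM (ger0_norm (ltW tV0)).
  rewrite (le_trans (m_le (ltW t0)))// ler_wpM2l//.
  by rewrite lerXn2r// nnegrE ltW.
have H3 : (1 + t) * `|delta t| <=
    (1 + t) * `|m t - m0 * q t ^+ 2| + `|beta t| * (`|b0| / 2).
  rewrite /delta (le_trans (ler_wpM2l _ (ler_normB _ _)))//; first lra.
  rewrite mulrDr lerD2l !normrM (ger0_norm (ltW q0)) normfV (ger0_norm
    (ler0n _ _)).
  by rewrite mulrCA qt mulr1.
have b02 : 0 <= `|b0| / 2 by rewrite divr_ge0.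
have H4 := ler_wpM2l b02 H1.
by rewrite /g /c3 /c1; lra.
Qed.

(** Integrability of [g] is delivered as a bounded primitive, the only form in which the energy
    argument uses it. The last inequality is what later gives lambda^2 <= (1 + t)^b0 exp M. *)
Lemma coefficient_majorant : exists Gam' g' : R -> R, exists M K' : R,
  [/\ forall t, 0 < t -> 2 * `|b t - b0 * (1 + t)^-1| + (1 + t) *
        `|m t - m0 * (1 + t)^-1 ^+ 2
          - (b t - b0 * (1 + t)^-1) * (b0 / 2) * (1 + t)^-1| <= g' t <= K',
    forall t, 0 < t -> is_derive t 1 Gam' (g' t),
    Gam' s @[s --> 0^'+] --> Gam' 0,
    Gam' 0 = 0 &
    forall t, 0 <= t -> Gam' t <= M /\
      \int[leb]_(s in `[0, t]) b s <= b0 * ln (1 + t) + M].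
Proof.
have dGam t : 0 < t -> is_derive t 1 Gam (g t) by exact: is_derive_primitive.
have cGam : Gam s @[s --> 0^'+] --> Gam 0 by exact: cvg_primitive.
have Gam0 : Gam 0 = 0 by exact: primitive_start.
have cGam' t : 0 <= t -> Gam s @[s --> t^'+] --> Gam t.
  rewrite le_eqVlt => /predU1P[<-//|t0]; apply: cvg_at_right_filter.
  exact: is_derive_continuous (dGam _ t0).
have Gam_nd s t : 0 <= s -> s <= t -> Gam s <= Gam t.
  move=> s0 st; rewrite -lerN2.
  apply: (@derive_le0_nincr _ (fun r => - Gam r) (fun r => - g r) s) => //.
  - move=> r sr; apply: (is_derive_ext (is_deriveN (dGam r _))) => //; lra.
  - by move=> r sr; rewrite oppr_le0 g_ge0//; lra.
  - exact: cvgN (cGam' _ s0).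
have ck1 : {within `[1, +oo[, continuous k1} by exact: (@ck b b0 1).
have ck2 : {within `[1, +oo[, continuous k2} by exact: (@ck m m0 2).
have k1_ge0 t : 1 <= t -> 0 <= k1 t by move=> t1; rewrite divr_ge0//; lra.
have k2_ge0 t : 1 <= t -> 0 <= k2 t by move=> t1; rewrite divr_ge0//; lra.
pose I1 := fine (\int[leb]_(t in `[1%R, +oo[) (k1 t)%:E)%E.
pose I2 := fine (\int[leb]_(t in `[1%R, +oo[) (k2 t)%:E)%E.
pose G1 t := \int[leb]_(s in `[1, t]) k1 s.
pose G2 t := \int[leb]_(s in `[1, t]) k2 s.
have G1I t : G1 t <= I1 by exact: primitive_le_integral.
have G2I t : G2 t <= I2 by exact: primitive_le_integral.
have c10 : 0 <= c1 by rewrite addr_ge0// divr_ge0.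
have c30 : 0 <= c3 by rewrite !addr_ge0// mulr_ge0.
(* [Gam 1 + c3] is the value at 1 of [Phi] below. On [0, 1], where the integral conditions say
   nothing, [Gam] is bounded by [Gam 1] through monotonicity. *)
pose M := Gam 1 + c3 + c1 * I1 + I2.
have I10 : 0 <= I1 by apply: le_trans (G1I 1); rewrite /G1 primitive_start.
have I20 : 0 <= I2 by apply: le_trans (G2I 1); rewrite /G2 primitive_start.
have GamM t : 0 <= t -> Gam t <= M.
  move=> t0; have [t1|t1] := leP t 1.
    have := Gam_nd _ _ t0 t1; have := mulr_ge0 c10 I10; rewrite /M; lra.
  (* The derivative of [c3 * t^-1] is -c3 t^-2, so [g_le] says exactly that [Phi] does not
     increase. *)
  pose Phi t : R := Gam t - c1 * G1 t - G2 t + c3 * t^-1.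
  have dPhi s : 1 < s -> is_derive s 1 Phi
      (g s - c1 * k1 s - k2 s - c3 * s^-1 ^+ 2).
    move=> s1; have sn0 : s != 0 by rewrite gt_eqF//; lra.
    have s0 : 0 < s by lra.
    have d1 := is_derive_primitive ck1 s1;
      have d2 := is_derive_primitive ck2 s1.
    have d3 := @is_deriveV _ id s _ 1 sn0 (is_derive_id s 1).
    apply: (is_derive_ext (is_deriveD (is_deriveB (is_deriveB (dGam _ s0)
      (is_deriveZ c1 d1)) d2) (is_deriveZ c3 d3))) => //.
    by rewrite !scaleRE /= exprVn; ring.
  have : Phi t <= Phi 1.
    apply: derive_le0_nincr dPhi _ _ _ (ltW t1) => [s s1|].
      by have := g_le (ltW s1); lra.
    apply: cvgD; last first.
      apply: cvgM; first exact: cvg_cst.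
      by apply: cvgV; [exact: oner_neq0|exact/cvg_at_right_filter/cvg_id].
    apply: cvgB; last exact: cvg_primitive.
    apply: cvgB; first exact: cGam'.
    by apply: cvgM; [exact: cvg_cst|exact: cvg_primitive].
  rewrite /Phi /G1 /G2 !primitive_start invr1.
  have := G1I t; move=> /(ler_wpM2l c10); have := G2I t.
  have : 0 <= c3 * t^-1 by rewrite mulr_ge0// invr_ge0.
  by rewrite /M /G1 /G2; lra.
exists Gam, g, M, K; split => //; first by move=> t /ltW; exact: g_bounds.
move=> t t0; split; first exact: GamM.
pose L t := \int[leb]_(s in `[0, t]) b s - b0 * ln (1 + t) - Gam t.
have dL s : 0 < s -> is_derive s 1 L (b s - b0 * q s - g s).
  move=> s0; have s1 : 0 < 1 + s by lra.
  have d1 := is_deriveD (is_derive_cst (1 : R) s 1) (is_derive_id s 1).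
  have d2 := @is_derive1_comp _
    (@ln R) (cst 1 + id) s _ _ (is_derive1_ln s1) d1.
  apply: (is_derive_ext (is_deriveB (is_deriveB (is_derive_primitive cb s0)
    (is_deriveZ b0 d2)) (dGam _ s0))) => //.
  by rewrite !scaleRE add0r mulr1.
have : L t <= L 0.
  apply: derive_le0_nincr dL _ _ _ t0 => [s s0|].
    rewrite subr_le0 (le_trans (ler_norm _))// /g -/(beta s).
    have : 0 <= (1 + s) * `|delta s| by rewrite mulr_ge0//; lra.
    by have := normr_ge0 (beta s); lra.
  apply: cvgB => //; apply: cvgB; first exact: cvg_primitive.
  by apply: cvgM; [exact: cvg_cst|exact: cvg_ln1D].
rewrite /L !primitive_start Gam0 addr0 ln1 mulr0 !subr0.
by have := GamM _ t0; lra.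
Qed.

End coefficients.

(** * Square-integrable functions and weak derivatives *)

Section L2_scalar_product.
Context {R : realType} {n : nat}.
Local Notation Rn := (n.-tuple R).
Local Notation mu := (lebesgue_tuple R n).
Implicit Types (f g h : Rn -> R[i]).
Local Notation reC := (@complex.Re R).
Local Notation imC := (@complex.Im R).

Lemma L2dotE f g :
  L2dot f g = \int[mu]_x (reC (f x) * reC (g x) + imC (f x) * imC (g x)).
Proof.
apply: eq_Rintegral => x _; case: (f x) => a b; case: (g x) => c d /=.
by ring.
Qed.

Lemma Lfun2_integrableM (f g : Rn -> R) : f \in Lfun mu 2%:E ->
  g \in Lfun mu 2%:E -> mu.-integrable setT (EFin \o (f \* g)).
Proof. by move=> f2 g2; apply/Lfun1_integrable/Lfun2_mul_Lfun1. Qed.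

Lemma L2dot_integrable f g : L2 f -> L2 g -> mu.-integrable setT
  (EFin \o (fun x => reC (f x) * reC (g x) + imC (f x) * imC (g x))).
Proof.
move=> [f1 f2] [g1 g2].
exact: (integrableD measurableT (Lfun2_integrableM f1 g1)
  (Lfun2_integrableM f2 g2)).
Qed.

Lemma L2D f g : L2 f -> L2 g -> L2 (f + g).
Proof.
move=> [f1 f2] [g1 g2]; split.
- rewrite (_ : (fun _ => _) = (fun x => reC (f x)) + (fun x => reC (g x))).
    exact: (Lfun_addr_closed mu (lee1n 2)).2.
  by apply/funext => x /=; rewrite !fctE; case: (f x); case: (g x).
- rewrite (_ : (fun _ => _) = (fun x => imC (f x)) + (fun x => imC (g x))).
    exact: (Lfun_addr_closed mu (lee1n 2)).2.
  by apply/funext => x /=; rewrite !fctE; case: (f x); case: (g x).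
Qed.

Lemma L2Z (a : R) f : L2 f -> L2 (fun x => a%:C%C * f x).
Proof.
move=> [f1 f2]; split.
- rewrite (_ : (fun _ => _) = a \o* (fun x => reC (f x))).
    by rewrite Lfun_scale// ler1n.
  by apply/funext => x /=; case: (f x) => ? ? /=; ring.
- rewrite (_ : (fun _ => _) = a \o* (fun x => imC (f x))).
    by rewrite Lfun_scale// ler1n.
  by apply/funext => x /=; case: (f x) => ? ? /=; ring.
Qed.

Lemma L2B f g : L2 f -> L2 g -> L2 (f - g).
Proof.
move=> f2 /(L2Z (-1)) g2; rewrite (_ : f - g = f + (fun x => (-1)%:C%C * g x)).
  exact: L2D.
apply/funext => x; rewrite !fctE; congr (_ + _).
by case: (g x) => a b; apply/eqP; rewrite eq_complex /=; apply/andP; split;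
  apply/eqP; ring.
Qed.

Lemma L2dotC f g : L2dot f g = L2dot g f.
Proof.
by rewrite !L2dotE; apply: eq_Rintegral => x _; congr (_ + _); rewrite mulrC.
Qed.

Lemma L2dotDl f g h : L2 f -> L2 g -> L2 h ->
  L2dot (f + g) h = L2dot f h + L2dot g h.
Proof.
move=> f2 g2 h2; rewrite !L2dotE -RintegralD//; [|exact: L2dot_integrable..].
apply: eq_Rintegral => x _; rewrite !fctE.
by case: (f x) => ? ?; case: (g x) => ? ? /=; ring.
Qed.

Lemma L2dotZl (a : R) f g : L2 f -> L2 g ->
  L2dot (fun x => a%:C%C * f x) g = a * L2dot f g.
Proof.
move=> f2 g2; rewrite !L2dotE -RintegralZl//; last exact: L2dot_integrable.
by apply: eq_Rintegral => x _; case: (f x) => ? ? /=; ring.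
Qed.

Lemma L2dotBl f g h : L2 f -> L2 g -> L2 h ->
  L2dot (f - g) h = L2dot f h - L2dot g h.
Proof.
move=> f2 g2 h2; apply/eqP; rewrite eq_sym subr_eq -L2dotDl ?subrK//.
exact: L2B.
Qed.

Lemma L2dotBr f g h : L2 f -> L2 g -> L2 h ->
  L2dot h (f - g) = L2dot h f - L2dot h g.
Proof. by move=> *; rewrite L2dotC L2dotBl// !(L2dotC h). Qed.

Lemma L2dotZr (a : R) f g : L2 f -> L2 g ->
  L2dot g (fun x => a%:C%C * f x) = a * L2dot g f.
Proof. by move=> *; rewrite L2dotC L2dotZl// (L2dotC g). Qed.

Lemma L2dot_ge0 f : 0 <= L2dot f f.
Proof.
by rewrite L2dotE; apply: Rintegral_ge0 => x _;
  rewrite addr_ge0// -expr2 sqr_ge0.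
Qed.

Lemma L2normE f : L2norm f = Num.sqrt (L2dot f f).
Proof.
rewrite L2dotE /L2norm unlock.
under [in LHS]eq_integral => x _.
  rewrite (_ : (_ `^ 2)%E =
    (reC (f x) * reC (f x) + imC (f x) * imC (f x))%:E); last first.
    case: (f x) => a b.
      rewrite [Normc.normc _]/= abse_EFin poweR_EFin ger0_norm ?sqrtr_ge0//.
    rewrite -[X in powR _ X]/(2%:R) powR_mulrn ?sqrtr_ge0// sqr_sqrtr//.
    by rewrite addr_ge0// sqr_ge0.
  over.
set I := (\int[_]_(_ in _) _)%E.
rewrite /Rintegral -/I.
have : (0 <= I)%E.
  by apply: integral_ge0 => x _; rewrite lee_fin addr_ge0// -expr2 sqr_ge0.
(* For an infinite integral both sides are 0, the value of [fine] at infinity; no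
   square-integrability is assumed. *)
case: I => [r|_|] //; last by rewrite poweRyr ?invr_eq0// sqrtr0.
by rewrite lee_fin => r0; rewrite poweR_EFin /= powR12_sqrt.
Qed.

Lemma L2norm_ge0 f : 0 <= L2norm f.
Proof. by rewrite L2normE sqrtr_ge0. Qed.

Lemma L2norm_sqr f : L2norm f ^+ 2 = L2dot f f.
Proof. by rewrite L2normE sqr_sqrtr ?L2dot_ge0. Qed.

Lemma L2normZ (a : R) f : L2 f ->
  L2norm (fun x => a%:C%C * f x) = `|a| * L2norm f.
Proof.
move=> f2; rewrite !L2normE L2dotZl//; last exact: L2Z.
by rewrite L2dotZr// mulrA -expr2 sqrtrM ?sqr_ge0// sqrtr_sqr.
Qed.

Lemma L2dot_quad_ge0 (a c : R) f g : L2 f -> L2 g ->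
  0 <= a ^+ 2 * L2dot f f + 2 * (a * c * L2dot f g) + c ^+ 2 * L2dot g g.
Proof.
move=> f2 g2; have af := L2Z a f2; have cg := L2Z (- c) g2.
have := L2dot_ge0 ((fun x => a%:C%C * f x) - (fun x => (- c)%:C%C * g x)).
rewrite L2dotBl ?L2dotBr//; last exact: L2B.
by rewrite !(L2dotZl, L2dotZr)// (L2dotC g f) => K; lra.
Qed.

Lemma L2dot_sqr_le f g : L2 f -> L2 g ->
  L2dot f g ^+ 2 <= L2dot f f * L2dot g g.
Proof.
move=> f2 g2; set z := L2dot f g; set X := L2dot f f; set Y := L2dot g g.
have H a c : 0 <= a ^+ 2 * X + 2 * (a * c * z) + c ^+ 2 * Y.
  exact: L2dot_quad_ge0.
have [Yp|Yn] := ltP 0 Y.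
  have := H Y (- z); rewrite (_ : _ + _ = Y * (X * Y - z ^+ 2)); last by ring.
  by rewrite pmulr_rge0// subr_ge0.
have Y0 : Y = 0 by apply/eqP; rewrite eq_le Yn L2dot_ge0.
have [->|z0] := eqVneq z 0; first by rewrite Y0 expr0n mulr0.
(* With Y = 0 the form is affine in its second argument, and this choice would give it the value
   -1. *)
have := H 1 (- (X + 1) / (2 * z)).
by rewrite Y0 (_ : _ + _ = - 1) ?oppr_ge0 ?ler10//; field.
Qed.

Lemma L2dot_le f g : L2 f -> L2 g -> `|L2dot f g| <= L2norm f * L2norm g.
Proof.
move=> f2 g2; rewrite -(@ler_pXn2r _ 2)// ?nnegrE ?mulr_ge0 ?L2norm_ge0//.
by rewrite exprMn !L2norm_sqr real_normK ?num_real// L2dot_sqr_le.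
Qed.

(** The error splits as (w1 - f, w2 - g) + (w1 - f, g) + (f, w2 - g). The filter is arbitrary
    because limits are taken along punctured, one-sided and two-variable neighbourhoods. *)
Lemma L2dot_cvg (T : Type) (F : set_system T) (FF : Filter F)
    (w1 w2 : T -> Rn -> R[i]) f g :
  (\forall s \near F, L2 (w1 s)) -> (\forall s \near F, L2 (w2 s)) ->
  L2 f -> L2 g ->
  L2norm (w1 s - f) @[s --> F] --> 0 -> L2norm (w2 s - g) @[s --> F] --> 0 ->
  L2dot (w1 s) (w2 s) @[s --> F] --> L2dot f g.
Proof.
move=> F1 F2 f2 g2 c1 c2.
have bound : (fun s => L2norm (w1 s - f) * L2norm (w2 s - g) +
    L2norm (w1 s - f) * L2norm g + L2norm f * L2norm (w2 s - g)) @ F --> 0.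
  rewrite -[X in _ --> X](_ : 0 * 0 + 0 * L2norm g + L2norm f * 0 = 0);
    last by ring.
  apply: cvgD; first apply: cvgD.
  - exact: cvgM.
  - by apply: cvgM => //; exact: cvg_cst.
  - by apply: cvgM => //; exact: cvg_cst.
apply/subr_cvg0/cvgr0Pnorm_lt => e e0.
have le_e := cvgr0_norm_lt _ bound _ e0.
near=> s; apply: (@le_lt_trans _ _ (L2norm (w1 s - f) * L2norm (w2 s - g) +
    L2norm (w1 s - f) * L2norm g + L2norm f * L2norm (w2 s - g))); last first.
  by apply: le_lt_trans (ler_norm _) _; near: s; exact: le_e.
have w1s : L2 (w1 s) by near: s.
have w2s : L2 (w2 s) by near: s.
have d1 := L2B w1s f2; have d2 := L2B w2s g2.
rewrite (_ : _ - _ = L2dot (w1 s - f) (w2 s - g) + L2dot (w1 s - f) g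
  + L2dot f (w2 s - g)); last by rewrite !(L2dotBl, L2dotBr)//; ring.
apply: (le_trans (ler_normD _ _)); apply: lerD; last exact: L2dot_le.
by apply: (le_trans (ler_normD _ _)); apply: lerD; exact: L2dot_le.
Unshelve. all: by end_near. Qed.

End L2_scalar_product.

(** * Integrals of functions equal almost everywhere *)

Section ae_equal_integrands.
Import HBNNSimple.
Context d (T : measurableType d) (R : realType).
Variable mu : {measure set T -> \bar R}.
Local Open Scope ereal_scope.

(* No measurability is required: the integral of a nonnegative function is the
   supremum of the integrals of the simple functions below it, and setting a
   simple function to 0 on a null set does not change its integral. *)
Lemma ge0_le_integral_ae (f g : T -> \bar R) :
  (forall x, 0 <= f x) -> (forall x, 0 <= g x) ->
  {ae mu, forall x, f x = g x} -> \int[mu]_x f x <= \int[mu]_x g x.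
Proof.
move=> f0 g0 [N [mN N0 fgN]].
rewrite (ge0_integralTE mu f0) (ge0_integralTE mu g0).
apply: ge_ereal_sup => _ /= [h hf <-].
have mCN : measurable (~` N) by exact: measurableC.
pose h' := proj_nnsfun h mCN.
have -> : sintegral mu h = sintegral mu h'.
  rewrite -!integralT_nnsfun; apply: ae_eq_integral => //.
  - exact/measurable_EFinP.
  - exact/measurable_EFinP.
  exists N; split => // x /= hx; apply: contrapT => xN; apply: hx => _.
  by rewrite mindicE mem_set// mulr1.
apply: ereal_sup_ubound; exists h' => // x; rewrite /h' /= mindicE.
have [xN|xN] := boolP (x \in ~` N); last by rewrite mulr0.
rewrite mulr1 (_ : g x = f x)//; apply: contrapT => fg.
by move: xN; rewrite inE => /=; apply; apply: fgN => fgx; exact: fg.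
Qed.

Lemma eq_integral_ae (f g : T -> \bar R) :
  {ae mu, forall x, f x = g x} -> \int[mu]_x f x = \int[mu]_x g x.
Proof.
move=> fg; have gf : {ae mu, forall x, g x = f x} by apply: filterS fg.
rewrite [LHS]integralE [RHS]integralE; congr (_ - _); apply/eqP; rewrite eq_le;
apply/andP; split; apply: ge0_le_integral_ae => //; apply: filterS fg => x;
by rewrite ?funeposE ?funenegE => ->.
Qed.

End ae_equal_integrands.

Section ae_equal_sobolev.
Context {R : realType} {n : nat}.
Local Notation Rn := (n.-tuple R).
Local Notation mu := (lebesgue_tuple R n).
Implicit Types f g h : Rn -> R[i].

Lemma eq_cintegral_ae f g :
  {ae mu, forall x, f x = g x} -> cintegral f = cintegral g.
Proof.
move=> fg; rewrite /cintegral; congr Complex; congr fine;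
by apply: eq_integral_ae; apply: filterS fg => x ->.
Qed.

Lemma L2norm_ae f g : {ae mu, forall x, f x = g x} -> L2norm f = L2norm g.
Proof.
move=> fg; rewrite !L2normE /L2dot
  (@eq_cintegral_ae _ (fun x => g x * (g x)^*%C))//.
by apply: filterS fg => x ->.
Qed.

(** Equality holds everywhere, not just almost everywhere: [f] and [g] have the same set of weak
    derivatives, and [xget] depends on that set alone. *)
Lemma weak_pd_ae i f g : {ae mu, forall x, f x = g x} ->
  weak_pd i f = weak_pd i g.
Proof.
move=> fg; congr xget; apply/seteqP; split => h /= [h2 hw];
  split => // phi tphi;
rewrite -hw//; apply: eq_cintegral_ae; by apply: filterS fg => x ->.
Qed.

Lemma gradnorm_ae f g : {ae mu, forall x, f x = g x} ->
  gradnorm f = gradnorm g.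
Proof.
move=> fg; congr Num.sqrt; apply: eq_bigr => i _.
by rewrite (weak_pd_ae i fg).
Qed.

Lemma gradnorm_sqr f :
  gradnorm f ^+ 2 = \sum_(i < n) L2dot (weak_pd i f) (weak_pd i f).
Proof.
rewrite sqr_sqrtr; first by apply: eq_bigr => i _; rewrite L2norm_sqr.
by apply: sumr_ge0 => i _; exact: sqr_ge0.
Qed.

Lemma L2_weak_pd i f : H1 f -> L2 (weak_pd i f).
Proof. by case=> _ /(_ i)[g gP];
  have [] := @xgetI _ (cst 0) [set g | L2 g /\ is_weak_pd i f g] g gP. Qed.

End ae_equal_sobolev.

(** * The energy identity for weak solutions *)

Section L2_curves.
Context {R : realType} {n : nat}.
Local Notation Rn := (n.-tuple R).
Implicit Types (w : R -> Rn -> R[i]) (t h : R).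

Definition L2_derivable_at w (w' : Rn -> R[i]) t :=
  L2norm (fun x => ((s - t)^-1)%:C%C * (w s x - w t x) - w' x) @[s --> t^']
    --> (0 : R).

(** Restricting to positive times makes two-sided neighbourhoods available; time 0 is treated
    separately by right limits. *)
Definition L2_curve w := forall t, 0 < t ->
  L2 (w t) /\ (L2norm (w s - w t) @[s --> t] --> (0 : R)).

Lemma L2_curve_dot_cvg (T : Type) (F : set_system T) (FF : Filter F)
    (r1 r2 : T -> R) t1 t2 w1 w2 :
  L2_curve w1 -> L2_curve w2 -> 0 < t1 -> 0 < t2 ->
  r1 @ F --> t1 -> r2 @ F --> t2 ->
  L2dot (w1 (r1 s)) (w2 (r2 s)) @[s --> F] --> L2dot (w1 t1) (w2 t2).
Proof.
move=> cw1 cw2 t10 t20 r1t r2t.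
have [w1t c1] := cw1 _ t10; have [w2t c2] := cw2 _ t20.
apply: L2dot_cvg => //.
- near=> s; have [] := cw1 (r1 s); first by near: s; exact: cvgr_gt r1t _ t10.
  by [].
- near=> s; have [] := cw2 (r2 s); first by near: s; exact: cvgr_gt r2t _ t20.
  by [].
- exact: (cvg_comp _ _ r1t c1).
- exact: (cvg_comp _ _ r2t c2).
Unshelve. all: by end_near. Qed.

(** A product rule for w1 = u_t: [w1] need only be continuous in norm and differentiable when paired
    with the fixed vector [w2 t]. The increment splits as (w1 s - w1 t, w2 t) + (w1 s, w2 s - w2
    t). *)
Lemma is_derive_L2dot w1 w2 (w2' : Rn -> R[i]) d t :
  (\forall s \near t, L2 (w1 s)) -> (\forall s \near t, L2 (w2 s)) ->
  L2 w2' -> L2norm (w1 s - w1 t) @[s --> t] --> (0 : R) ->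
  (L2dot (w1 s) (w2 t) - L2dot (w1 t) (w2 t)) / (s - t) @[s --> t^'] --> d ->
  L2_derivable_at w2 w2' t ->
  is_derive t 1 (fun s => L2dot (w1 s) (w2 s)) (d + L2dot (w1 t) w2').
Proof.
move=> near1 near2 l2 c1 d1 d2; apply: is_derive_diffquot.
have w1t := nbhs_singleton near1; have w2t := nbhs_singleton near2.
have d3 : L2dot (w1 s) (fun x => ((s - t)^-1)%:C%C * (w2 s - w2 t) x)
    @[s --> t^'] --> L2dot (w1 t) w2'.
  apply: L2dot_cvg => //.
  - exact: nbhs_dnbhs.
  - near=> s; apply/L2Z/L2B => //; near: s; exact: nbhs_dnbhs.
  - by apply: cvg_trans c1; apply: cvg_app; exact: nbhs_dnbhs.
apply: cvg_trans (cvgD d1 d3); apply: near_eq_cvg; near=> s => /=.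
have w1s : L2 (w1 s) by near: s; exact: nbhs_dnbhs.
have w2s : L2 (w2 s) by near: s; exact: nbhs_dnbhs.
rewrite fctE L2dotZr//; last exact: L2B.
rewrite L2dotBr//; ring.
Unshelve. all: by end_near. Qed.

Lemma L2dot_diffquot_cvg w (w' v : Rn -> R[i]) t :
  (\forall s \near t, L2 (w s)) -> L2 w' -> L2 v -> L2_derivable_at w w' t ->
  (L2dot (w s) v - L2dot (w t) v) / (s - t) @[s --> t^'] --> L2dot w' v.
Proof.
move=> wL2 w'2 v2 dw; have wt := nbhs_singleton wL2.
have c : L2dot (fun x => ((s - t)^-1)%:C%C * (w s - w t) x) v
    @[s --> t^'] --> L2dot w' v.
  apply: L2dot_cvg => //.
  - by near=> s; apply/L2Z/L2B => //; near: s; exact: nbhs_dnbhs.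
  - by near=> s.
  - rewrite (_ : (fun _ => _) = cst 0); first exact: cvg_cst.
    by apply/funext => r;
      rewrite L2normE L2dotBl ?(subrr (L2dot _ _)) ?sqrtr0//;
      exact: L2B.
apply: cvg_trans c; apply: near_eq_cvg; near=> s => /=.
have ws : L2 (w s) by near: s; exact: nbhs_dnbhs.
rewrite [LHS]L2dotZl//; last exact: L2B.
by rewrite L2dotBl// mulrC.
Unshelve. all: by end_near. Qed.

Lemma L2_curve_near w t : L2_curve w -> 0 < t -> \forall s \near t, L2 (w s).
Proof.
move=> cw t0; near=> s; have [|//] := cw s; near: s; exact: lt_nbhsr.
Unshelve. all: by end_near. Qed.

Lemma L2_curve_shift_near w t h : L2_curve w -> 0 < t + h ->
  \forall s \near t, L2 (w (s + h)).
Proof.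
move=> cw t0; near=> s; have [|//] := cw (s + h); near: s.
by near do rewrite -ltrBlDr sub0r; apply: lt_nbhsr; lra.
Unshelve. all: by end_near. Qed.

Lemma L2_derivable_at_shift w (w' : Rn -> R[i]) h t :
  L2_derivable_at w w' (t + h) -> L2_derivable_at (fun s => w (s + h)) w' t.
Proof.
rewrite /L2_derivable_at => H.
have c := cvg_comp _ _ (@cvg_dnbhs_shift _ h t) H.
apply: cvg_trans c.
apply: near_eq_cvg; near=> s => /=; congr L2norm; apply/funext => x.
by congr (_%:C%C * _ - _); congr (_^-1); ring.
Unshelve. all: by end_near. Qed.

End L2_curves.

Section energy_identity.
Context {R : realType} {n : nat}.
Local Notation Rn := (n.-tuple R).
(** Here [f] stands for b u_t + m u and [du i] for the weak partial derivatives. The equation is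
    tested only with values [u s], where [s] may differ from [t]: this admits the translates u(t +
    h) and u(t - h). *)
Variables (u ut f : R -> Rn -> R[i]) (du : 'I_n -> R -> Rn -> R[i]).
Hypotheses (cu : L2_curve u) (cut : L2_curve ut) (cf : L2_curve f)
  (cdu : forall i, L2_curve (du i)).
Hypothesis u_derivable : forall t, 0 < t -> L2_derivable_at u (ut t) t.
Hypothesis weak_eq : forall s t, 0 < s -> 0 < t ->
  (L2dot (ut r) (u s) - L2dot (ut t) (u s)) / (r - t) @[r --> t^'] -->
  - (\sum_(i < n) L2dot (du i t) (du i s) + L2dot (f t) (u s)).
Implicit Types (s t h a : R).

Lemma is_derive_L2dot_cst (v : Rn -> R[i]) t : L2 v -> 0 < t ->
  is_derive t 1 (fun s => L2dot v (u s)) (L2dot v (ut t)).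
Proof.
move=> v2 t0; apply: is_derive_diffquot.
under eq_cvg do rewrite !(L2dotC v).
rewrite L2dotC; apply: L2dot_diffquot_cvg => //.
- exact: L2_curve_near.
- by have [] := cut t0.
- exact: u_derivable.
Qed.

Lemma L2dot_MVT (v : Rn -> R[i]) t h : L2 v -> 0 < h < t ->
  exists2 r, `|r - t| <= h &
    L2dot v (u (t + h)) - L2dot v (u (t - h)) = L2dot v (ut r) * (2 * h).
Proof.
move=> v2 /andP[h0 ht].
have [||r /andP[? ?] ->] := @MVT_derive _ (fun s => L2dot v (u s))
    (fun s => L2dot v (ut s)) (t - h) (t + h); first by lra.
  by move=> s /andP[? ?]; apply: is_derive_L2dot_cst => //; lra.
exists r; first by rewrite ler_norml; lra.
by congr (_ * _); ring.
Qed.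

Lemma is_derive_L2dot_self t : 0 < t ->
  is_derive t 1 (fun s => L2dot (u s) (u s)) (2 * L2dot (u t) (ut t)).
Proof.
move=> t0; have [u2 uc] := cu t0; have [ut2 _] := cut t0.
have un := L2_curve_near cu t0; have du_t := u_derivable t0.
have c := L2dot_diffquot_cvg un ut2 u2 du_t.
apply: (is_derive_ext (is_derive_L2dot un un ut2 uc c du_t)) => //.
by rewrite (L2dotC (ut t)); ring.
Qed.

Lemma virial_identity t : 0 < t ->
  is_derive t 1 (fun s => L2dot (ut s) (u s))
    (L2dot (ut t) (ut t) - \sum_(i < n) L2dot (du i t) (du i t)
     - L2dot (f t) (u t)).
Proof.
move=> t0; have [ut2 utc] := cut t0.
have un := L2_curve_near cu t0; have utn := L2_curve_near cut t0.
apply: (is_derive_ext (is_derive_L2dot utn un ut2 utc (weak_eq t0 t0)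
  (u_derivable t0))) => //.
ring.
Qed.

(** The polarised Lagrangian |u_t|^2 - |grad u|^2. By the equation, (u_t(t), u(t + k)) has
    derivative [lagrangian t (t + k)] - (f(t), u(t + k)). *)
Let lagrangian s t :=
  L2dot (ut s) (ut t) - \sum_(i < n) L2dot (du i s) (du i t).

Let lagrangian_cvg (T : Type) (F : set_system T) (FF : Filter F)
    (r1 r2 : T -> R) t1 t2 : 0 < t1 -> 0 < t2 ->
  r1 @ F --> t1 -> r2 @ F --> t2 ->
  lagrangian (r1 s) (r2 s) @[s --> F] --> lagrangian t1 t2.
Proof.
move=> t10 t20 c1 c2; apply: cvgB; first exact: L2_curve_dot_cvg.
apply: cvg_big => [|i _]; last exact: L2_curve_dot_cvg.
exact: add_continuous.
Qed.

Let lagrangianC s t : lagrangian s t = lagrangian t s.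
Proof.
rewrite /lagrangian L2dotC; congr (_ - _).
by apply: eq_bigr => i _; rewrite L2dotC.
Qed.

(* The equation cannot be tested with u_t, which need not lie in H^1; it is
   tested with the difference quotient of u, whose pairings with u_tt and u
   are differences of time translates of the same functions. *)
Lemma difference_quotient_energy a h : 0 < h < a ->
  exists E : R -> R, forall t, a + h < t ->
    (exists2 r, `|r - t| <= h & is_derive t 1 E (- 2 * L2dot (f t) (ut r))) /\
    (exists r1 r2 r3, [/\ `|r1 - t| <= h, `|r2 - t| <= h, `|r3 - t| <= h + h &
      E t = 2 * L2dot (ut t) (ut r1) - lagrangian r2 r3]).
Proof.
move=> /andP[h0 ha]; have a0 : 0 < a by exact: lt_trans ha.
have [S dS] : exists S : R -> R, forall t, a < t ->
    is_derive t 1 S (lagrangian t (t + h)).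
  apply: antiderivative => t at_; have t0 : 0 < t by exact: lt_le_trans at_.
  apply: lagrangian_cvg; [by []|lra|exact: cvg_id|].
  by apply: cvgD; [exact: cvg_id|exact: cvg_cst].
(* [S t - S (t - h)] integrates [lagrangian s (s + h)] over [t - h, t]. As h tends to 0 the whole
   tends to 2 |u_t|^2 - (|u_t|^2 - |grad u|^2), which is the energy. *)
exists (fun t => (L2dot (ut t) (u (t + h)) - L2dot (ut t) (u (t - h)) -
  (S t - S (t - h))) / h) => t aht.
have t0 : 0 < t by lra.
have thp : 0 < t + h by lra.
have thn : 0 < t - h by lra.
split; last first.
  have [l1 _] := cut t0.
  have [|r1 r1t e1] := @L2dot_MVT (ut t) t h l1; first by apply/andP; lra.
  have [||r2 /andP[? ?] e2] := @MVT_derive _ S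
    (fun s => lagrangian s (s + h)) (t - h) t; first by lra.
    by move=> s /andP[? ?]; apply: dS; lra.
  exists r1, r2, (r2 + h); split => //; [by rewrite ler_norml; lra..|].
  by rewrite e1 e2; field; lra.
have [l1 _] := cf t0.
have [|r rt e] := @L2dot_MVT (f t) t h l1; first by apply/andP; lra.
exists r => //.
have dP k : 0 < t + k -> is_derive t 1 (fun s => L2dot (ut s) (u (s + k)))
    (- (\sum_(i < n) L2dot (du i t) (du i (t + k)) + L2dot (f t) (u (t + k))) +
     L2dot (ut t) (ut (t + k))).
  move=> tk; apply: is_derive_L2dot.
  - exact: L2_curve_near.
  - exact: L2_curve_shift_near.
  - by have [] := cut tk.
  - by have [] := cut t0.
  - exact: weak_eq.
  - exact/L2_derivable_at_shift/u_derivable.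
have dS1 : is_derive t 1 (fun s => S (s - h)) (lagrangian (t - h) t).
  have := dS (t - h); rewrite subrK => dSth.
  rewrite -[lagrangian _ _]mulr1;
    apply: (@is_derive1_comp _ S (fun s => s - h)).
    by apply: dSth; lra.
  by apply: is_derive_eq; rewrite subr0.
have dS0 : is_derive t 1 S (lagrangian t (t + h)) by apply: dS; lra.
apply: (is_derive_ext (is_deriveZ h^-1
  (is_deriveB (is_deriveB (dP _ thp) (dP _ thn)) (is_deriveB dS0 dS1)))).
  by move=> s; rewrite /GRing.scale /= !fctE /= mulrC.
rewrite /GRing.scale /= (lagrangianC (t - h)) /lagrangian.
(* By its symmetry the Lagrangian at (t, t - h) is its value at (t - h, t), so both Lagrangian terms
   cancel against the derivative of S(t) - S(t - h). *)
rewrite (_ : _ - _ = - (L2dot (f t) (u (t + h)) - L2dot (f t) (u (t - h)))).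
  by rewrite e; field; lra.
by ring.
Qed.

(** The functions of [difference_quotient_energy] converge pointwise to the energy while their
    derivatives near [t] stay uniformly close to -2 (f, u_t); the mean value theorem carries this
    over to the limit. *)
Lemma energy_identity t : 0 < t ->
  is_derive t 1 (fun s => L2dot (ut s) (ut s) +
    \sum_(i < n) L2dot (du i s) (du i s)) (- 2 * L2dot (f t) (ut t)).
Proof.
move=> t0; pose e s :=
  L2dot (ut s) (ut s) + \sum_(i < n) L2dot (du i s) (du i s).
pose phi := L2dot (f t) (ut t); change (is_derive t 1 e (- 2 * phi)).
have near2 (g : R -> R -> R) s : g (x.1) (x.2) @[x --> (s, s)] --> g s s ->
    forall eps : R, 0 < eps -> exists2 d : R, 0 < d & forall r1 r2,
      `|r1 - s| < d -> `|r2 - s| < d -> `|g r1 r2 - g s s| < eps.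
  move=> /cvgrPdistC_lt cg eps eps0; have := cg _ eps0.
  rewrite near_simpl => /nbhs_ballP[d /= d0 bd]; exists d => // r1 r2 r1s r2s.
  by apply: (bd (r1, r2)); split; rewrite /ball /= distrC.
have jc (w1 w2 : R -> Rn -> R[i]) s : 0 < s -> L2_curve w1 -> L2_curve w2 ->
    L2dot (w1 x.1) (w2 x.2) @[x --> (s, s)] --> L2dot (w1 s) (w2 s).
  by move=> s0 ? ?; apply: L2_curve_dot_cvg => //;
    [exact: cvg_fst|exact: cvg_snd].
have key (eps : R) : 0 < eps -> exists2 d : R, 0 < d & forall k, `|k| < d ->
    `|e (t + k) - e t + 2 * phi * k| <= 2 * eps * `|k|.
  move=> eps0.
  have [d0 d00 near_phi] := near2 (fun r1 r2 => L2dot (f r1) (ut r2)) t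
    (jc _ _ _ t0 cf cut) _ eps0.
  (* The mean value point is within d of t and the point [r] within h < d of it, hence 2 d <= d0;
     the bound t / 8 keeps all times above t / 4 + h. *)
  have [d [d0' dd0 dt]] : exists d, [/\ 0 < d, d <= d0 / 2 & d <= t / 8].
    exists (Num.min (d0 / 2) (t / 8)).
    by rewrite lt_min !ge_min !lexx orbT; split => //; apply/andP; split; lra.
  exists d => // k kd; apply/ler_addgt0Pr => eta eta0.
  (* The values given by [difference_quotient_energy] tend to e as h -> 0. *)
  have approx s : 0 < s -> exists2 h1 : R, 0 < h1 & forall h, 0 < h < h1 ->
      forall r1 r2 r3, `|r1 - s| <= h -> `|r2 - s| <= h -> `|r3 - s| <= h + h ->
      `|2 * L2dot (ut s) (ut r1) - lagrangian r2 r3 - e s| <= eta / 2.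
    (* The first pairing is doubled: 2 (eta / 6) + eta / 6 = eta / 2, and the two end points [t] and
       [t + k] make up [eta]. *)
    move=> s0; have eta6 : 0 < eta / 6 by lra.
    have [h1 h10 H1] := near2 (fun r1 r2 => L2dot (ut r1) (ut r2)) s
      (jc _ _ _ s0 cut cut) _ eta6.
    have [|h2 h20 H2] := near2 lagrangian s _ _ eta6.
      by apply: lagrangian_cvg => //; [exact: cvg_fst|exact: cvg_snd].
    exists (Num.min h1 (h2 / 2)); first by rewrite lt_min; apply/andP; split;
      lra.
    move=> h; rewrite lt_min => /and3P[hp hh1 hh2] r1 r2 r3 r1s r2s r3s.
    have := H1 s r1; rewrite subrr normr0 => /(_ h10 (le_lt_trans r1s hh1)).
    have := H2 r2 r3 (le_lt_trans r2s _) (le_lt_trans r3s _).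
    move=> /(_ ltac:(lra) ltac:(lra)).
    rewrite {2}/lagrangian /e !ltr_norml ler_norml; lra.
  have tk0 : 0 < t + k by move: kd; rewrite ltr_norml; lra.
  have [h1 h10 H1] := approx _ t0; have [h2 h20 H2] := approx _ tk0.
  have [h [h0 hd hh1 hh2]] : exists h, [/\ 0 < h, h < d, h < h1 & h < h2].
    exists (Num.min d (Num.min h1 h2) / 2).
    have : 0 < Num.min d (Num.min h1 h2) by rewrite !lt_min d0' h10.
    have := lexx (Num.min d (Num.min h1 h2)); rewrite !le_min.
    by move=> /and3P[? ? ?] ?; split; lra.
  have [|E HE] := @difference_quotient_energy (t / 4) h; first by apply/andP;
    lra.
  have dE s : `|s - t| < d -> exists2 r, `|r - s| <= h &
      is_derive s 1 E (- 2 * L2dot (f s) (ut r)).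
    by rewrite ltr_norml => st; have [] := HE s; first by lra.
  have [c ct Ec] : exists2 c, `|c - t| <= `|k| & E (t + k) - E t = 'D_1 E c * k.
    apply: MVT_ball kd => s /dE[r _ Er].
    by rewrite (@derive_val _ _ _ _ _ _ _ Er).
  have [r rc Er] := dE _ (le_lt_trans ct kd).
  have {Ec} Ec : E (t + k) - E t = -2 * L2dot (f c) (ut r) * k.
    by rewrite Ec (@derive_val _ _ _ _ _ _ _ Er).
  have phi_c : `|L2dot (f c) (ut r) - phi| < eps.
    by apply: near_phi; move: (le_lt_trans ct kd) rc;
      rewrite !(ltr_norml, ler_norml); lra.
  have [|_ [r1 [r2 [r3 [r1t r2t r3t Et]]]]] := HE t; first by lra.
  have := H1 h _ r1 r2 r3 r1t r2t r3t;
    rewrite h0 hh1 -Et => /(_ isT) {r1t r2t r3t Et}.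
  have [|_ [s1 [s2 [s3 [s1t s2t s3t Et]]]]] := HE (t + k).
    by move: kd; rewrite ltr_norml; lra.
  have := H2 h _ s1 s2 s3 s1t s2t s3t;
    rewrite h0 hh2 -Et => /(_ isT) {s1t s2t s3t Et}.
  have : `|2 * (L2dot (f c) (ut r) - phi) * k| <= 2 * eps * `|k|.
    by rewrite !normrM ger0_norm// ler_wpM2r// ler_wpM2l// ltW.
  rewrite !ler_norml; have : 0 <= eps * `|k| by rewrite mulr_ge0// ltW.
  by move: Ec; lra.
apply: is_derive_diffquot; apply/cvgrPdistC_le => eps eps0.
have [|d d0 kd] := key (eps / 2); first by lra.
near=> s.
have st : s - t != 0 by rewrite subr_eq0; near: s; exact: nbhs_dnbhs_neq.
have : `|s - t| < d by rewrite distrC; near: s; apply: nbhs_dnbhs;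
  exact: nbhsx_ballx.
move=> /kd; rewrite (_ : t + (s - t) = s); last by ring.
rewrite -ler_pdivrMr ?normr_gt0// -normf_div.
rewrite (_ : 2 * (eps / 2) = eps); last by field.
by rewrite (_ : _ / (s - t) = (e s - e t) / (s - t) - -2 * phi)//; field.
Unshelve. all: by end_near. Qed.


End energy_identity.

(** * The estimate *)

Section L2_curve_algebra.
Context {R : realType} {n : nat}.
Local Notation Rn := (n.-tuple R).
Implicit Types (w : R -> Rn -> R[i]) (t : R).

(** Expanding |w(s) - w(t)|^2: convergence of the norms and of the pairings with the limit gives
    strong convergence. *)
Lemma L2_cvg_of_dot w t : (\forall s \near t, L2 (w s)) ->
  L2dot (w s) (w s) @[s --> t] --> L2dot (w t) (w t) ->
  L2dot (w s) (w t) @[s --> t] --> L2dot (w t) (w t) ->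
  L2norm (w s - w t) @[s --> t] --> (0 : R).
Proof.
move=> wL2 c1 c2; have wt := nbhs_singleton wL2.
have c : L2dot (w s) (w s) - 2 * L2dot (w s) (w t) + L2dot (w t) (w t)
    @[s --> t] --> (0 : R).
  rewrite -[X in _ --> X](_ : L2dot (w t) (w t) - 2 * L2dot (w t) (w t)
    + L2dot (w t) (w t) = 0); last by ring.
  apply: cvgD; last exact: cvg_cst.
  by apply: cvgB => //; apply: cvgM => //; exact: cvg_cst.
have := cvg_comp _ _ c (@sqrt_continuous R 0).
rewrite sqrtr0; apply: cvg_trans; apply: near_eq_cvg; near=> s.
have ws : L2 (w s) by near: s.
have d := L2B ws wt.
rewrite /= L2normE !(L2dotBl, L2dotBr)// (L2dotC (w t) (w s)).
by congr Num.sqrt; ring.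
Unshelve. all: by end_near. Qed.

Lemma L2_curveD w1 w2 : L2_curve w1 -> L2_curve w2 ->
  L2_curve (fun t => w1 t + w2 t).
Proof.
move=> cw1 cw2 t t0; have [w1t _] := cw1 _ t0; have [w2t _] := cw2 _ t0.
have n1 := L2_curve_near cw1 t0; have n2 := L2_curve_near cw2 t0.
have c w w' : L2_curve w -> L2_curve w' ->
    L2dot (w s) (w' s) @[s --> t] --> L2dot (w t) (w' t).
  by move=> ? ?; apply: L2_curve_dot_cvg => //; exact: cvg_id.
have c' w w' : L2_curve w -> L2_curve w' ->
    L2dot (w s) (w' t) @[s --> t] --> L2dot (w t) (w' t).
  by move=> ? ?;
    apply: (@L2_curve_dot_cvg _ _ _ (nbhs t) _ id (fun=> t)) => //;
      exact: cvg_cst.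
have ED (a1 a2 a3 a4 : Rn -> R[i]) : L2 a1 -> L2 a2 -> L2 a3 -> L2 a4 ->
    L2dot (a1 + a2) (a3 + a4) =
    L2dot a1 a3 + L2dot a1 a4 + (L2dot a2 a3 + L2dot a2 a4).
  move=> l1 l2 l3 l4; rewrite L2dotDl//; last exact: L2D.
  by rewrite !(L2dotC _ (a3 + a4)) !L2dotDl// !(L2dotC a3) !(L2dotC a4).
split; first exact: L2D.
apply: L2_cvg_of_dot.
- by near=> s; apply: L2D; near: s.
- rewrite ED//; apply: cvg_trans (cvgD (cvgD (c _ _ cw1 cw1) (c _ _ cw1 cw2))
    (cvgD (c _ _ cw2 cw1) (c _ _ cw2 cw2))).
  apply: near_eq_cvg; near=> s.
  have l1 : L2 (w1 s) by near: s.
  have l2 : L2 (w2 s) by near: s.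
  by rewrite /= [RHS]ED.
- rewrite ED//; apply: cvg_trans (cvgD (cvgD (c' _ _ cw1 cw1) (c' _ _ cw1 cw2))
    (cvgD (c' _ _ cw2 cw1) (c' _ _ cw2 cw2))).
  apply: near_eq_cvg; near=> s.
  have l1 : L2 (w1 s) by near: s.
  have l2 : L2 (w2 s) by near: s.
  by rewrite /= [RHS]ED.
Unshelve. all: by end_near. Qed.

Lemma L2_curveZ (c : R -> R) w : (forall t, 0 < t -> {for t, continuous c}) ->
  L2_curve w -> L2_curve (fun t x => (c t)%:C%C * w t x).
Proof.
move=> cc cw t t0; have [wt _] := cw _ t0; have nw := L2_curve_near cw t0.
split; first exact: L2Z.
apply: L2_cvg_of_dot.
- by near=> s; apply: L2Z; near: s.
- rewrite L2dotZl ?L2dotZr//; last exact: L2Z.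
  have d : L2dot (w s) (w s) @[s --> t] --> L2dot (w t) (w t).
    by apply: L2_curve_dot_cvg => //; exact: cvg_id.
  apply: cvg_trans (cvgM (cc _ t0) (cvgM (cc _ t0) d)); apply: near_eq_cvg.
  near=> s; have ws : L2 (w s) by near: s.
  by rewrite /= L2dotZl ?L2dotZr//; exact: L2Z.
- rewrite L2dotZl ?L2dotZr//; last exact: L2Z.
  have d : L2dot (w s) (w t) @[s --> t] --> L2dot (w t) (w t).
    by apply: (@L2_curve_dot_cvg _ _ _ (nbhs t) _ id (fun=> t)) => //;
      exact: cvg_cst.
  have cst_c : c t @[_ --> t] --> c t by exact: cvg_cst.
  apply: cvg_trans (cvgM (cc _ t0) (cvgM cst_c d)); apply: near_eq_cvg.
  near=> s; have ws : L2 (w s) by near: s.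
  by rewrite /= L2dotZl ?L2dotZr//; exact: L2Z.
Unshelve. all: by end_near. Qed.

(** Turns the limits within the half-line found in [solution] into two-sided ones at positive times;
    [at_right_halfline] is the counterpart at 0. *)
Lemma cvg_within_id (T U : Type) (F : set_system T) (G : set_system U)
    (D : set T) (f : T -> U) : Filter F -> F D ->
  f @ within D F `=>` G -> f @ F `=>` G.
Proof.
move=> FF FD fG P /fG; rewrite /= /within /=; apply: filterS2 FD => s Ds; exact.
Qed.

Lemma nbhs_halfline t : 0 < t -> nbhs t [set` `[0, +oo[].
Proof.
move=> t0; near=> s; rewrite /= in_itv /= andbT.
by apply: ltW; near: s; exact: lt_nbhsr.
Unshelve. all: by end_near. Qed.

Lemma at_right_halfline (G : set_system R) (f : R -> R) :
  f @ within [set` `[0, +oo[] (nbhs (0 : R)) `=>` G -> f @ (0 : R)^'+ `=>` G.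
Proof.
move=> fG P PG.
have H : nbhs (0 : R) [set s | [set` `[0, +oo[] s -> P (f s)] by exact: fG.
suff : nbhs (0 : R) [set s | 0 < s -> P (f s)] by [].
by apply: filterS H => s H s0; apply: H; rewrite /= in_itv /= andbT ltW.
Qed.

Lemma L2_continuous_curve w : (forall t, 0 <= t -> L2 (w t)) ->
  L2_continuous w -> L2_curve w.
Proof.
move=> w2 cw t t0; split; first by apply: w2; exact: ltW.
apply: (cvg_within_id _ (nbhs_halfline t0)); exact: cw (ltW t0).
Qed.

End L2_curve_algebra.

(** * From a weak solution to the scalar equations *)

Section weak_solution.
Context {R : realType} {n : nat}.
Local Notation Rn := (n.-tuple R).
Variables (b m : R -> R) (u0 u1 : Rn -> R[i]) (u ut : R -> Rn -> R[i]).
Hypotheses (cb : {within `[0, +oo[, continuous b})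
  (cm : {within `[0, +oo[, continuous m}).
Hypothesis u_sol : solution b m u0 u1 u ut.
Implicit Types t : R.

Let y t := L2dot (u t) (u t).
Let z t := L2dot (ut t) (u t).
Let X t := L2dot (ut t) (ut t).
Let G t := \sum_(i < n) L2dot (weak_pd i (u t)) (weak_pd i (u t)).
Let f t := (fun x => (b t)%:C%C * ut t x) + (fun x => (m t)%:C%C * u t x).

Let u_H1 t : 0 <= t -> H1 (u t).
Proof. by case: u_sol => H _ _ _ _ /H[]. Qed.

Let u_L2 t : 0 <= t -> L2 (u t).
Proof. by move=> /u_H1[]. Qed.

Let ut_L2 t : 0 <= t -> L2 (ut t).
Proof. by case: u_sol => H _ _ _ _ /H[]. Qed.

Let du_L2 i t : 0 <= t -> L2 (weak_pd i (u t)).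
Proof. by move=> t0; apply: L2_weak_pd; exact: u_H1. Qed.

Let cu : L2_curve u.
Proof. by case: u_sol => _ [c _] _ _ _; exact: L2_continuous_curve. Qed.

Let cut : L2_curve ut.
Proof. by case: u_sol => _ _ [_ c] _ _; exact: L2_continuous_curve. Qed.

Let cdu i : L2_curve (fun t => weak_pd i (u t)).
Proof.
case: u_sol => _ [_ c] _ _ _; apply: L2_continuous_curve (c i).
exact: du_L2.
Qed.

Let within_for (c : R -> R) : {within `[0, +oo[, continuous c} ->
  forall t, 0 < t -> {for t, continuous c}.
Proof.
move=> cc t t0; have [H _] := (continuous_within_itvcyP 0 c).1 cc.
by apply: H; rewrite in_itv /= andbT.
Qed.

Let cf : L2_curve f.
Proof.
by apply: L2_curveD; apply: L2_curveZ => //; exact: within_for.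
Qed.

Let dnbhs_halfline t : 0 < t -> t^' [set` `[0, +oo[].
Proof. by move=> t0; apply: nbhs_dnbhs; exact: nbhs_halfline. Qed.

Let u_derivable t : 0 < t -> L2_derivable_at u (ut t) t.
Proof.
move=> t0; case: u_sol => _ _ [d _] _ _.
by apply: (cvg_within_id _ (dnbhs_halfline t0)); exact: d (ltW t0).
Qed.

Let f_dot v t : 0 <= t -> L2 v ->
  L2dot (f t) v = b t * L2dot (ut t) v + m t * L2dot (u t) v.
Proof.
move=> t0 v2; have l1 := u_L2 t0; have l2 := ut_L2 t0.
by rewrite /f L2dotDl//; [rewrite !L2dotZl|exact: L2Z|exact: L2Z].
Qed.

Let weak_eq s t : 0 < s -> 0 < t ->
  (L2dot (ut r) (u s) - L2dot (ut t) (u s)) / (r - t) @[r --> t^'] -->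
  - (\sum_(i < n) L2dot (weak_pd i (u t)) (weak_pd i (u s))
     + L2dot (f t) (u s)).
Proof.
move=> s0 t0; rewrite f_dot ?addrA; [|exact: ltW|exact/u_L2/ltW].
case: u_sol => _ _ _ _ eqn; apply: (cvg_within_id _ (dnbhs_halfline t0)).
exact: eqn (u_H1 (ltW s0)) _ (ltW t0).
Qed.

Lemma solution_scalar_equations t : 0 < t ->
  [/\ is_derive t 1 y (2 * z t),
      is_derive t 1 z (X t - G t - b t * z t - m t * y t) &
      is_derive t 1 (fun s => X s + G s) (- 2 * (b t * X t + m t * z t))].
Proof.
move=> t0; have t0' := ltW t0; split.
- apply: (is_derive_ext (is_derive_L2dot_self cu cut u_derivable t0)) => //.
  by rewrite /z L2dotC.
- apply: (is_derive_ext (virial_identity cu cut u_derivable weak_eq t0)) => //.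
  by rewrite f_dot//; [rewrite /X /G /z /y; ring|exact: u_L2].
- apply: (is_derive_ext
  (energy_identity cu cut cf cdu u_derivable weak_eq t0)) => //.
  by rewrite f_dot//; [rewrite (L2dotC (u t))|exact: ut_L2].
Qed.

Let dot0 (w1 w2 : R -> Rn -> R[i]) :
  (forall t, 0 <= t -> L2 (w1 t)) -> (forall t, 0 <= t -> L2 (w2 t)) ->
  L2_continuous w1 -> L2_continuous w2 ->
  L2dot (w1 s) (w2 s) @[s --> 0^'+] --> L2dot (w1 0) (w2 0).
Proof.
move=> l1 l2 c1 c2; apply: L2dot_cvg.
- by near=> s; apply: l1; apply: ltW; near: s; exact: nbhs_right_gt.
- by near=> s; apply: l2; apply: ltW; near: s; exact: nbhs_right_gt.
- exact: l1.
- exact: l2.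
- by apply: at_right_halfline; exact: c1.
- by apply: at_right_halfline; exact: c2.
Unshelve. all: by end_near. Qed.

Lemma solution_scalar_cvg0 :
  [/\ y s @[s --> 0^'+] --> y 0, z s @[s --> 0^'+] --> z 0 &
      X s + G s @[s --> 0^'+] --> X 0 + G 0].
Proof.
case: u_sol => _ [c1 c2] [_ c3] _ _; split; [exact: dot0|exact: dot0|].
apply: cvgD; first exact: dot0.
apply: cvg_big => [|i _]; first exact: add_continuous.
by apply: (@dot0 (fun t => weak_pd i (u t)) (fun t => weak_pd i (u t))) => // t;
  exact: du_L2.
Qed.

Lemma solution_gram t : 0 <= t -> z t ^+ 2 <= X t * y t.
Proof. by move=> t0; apply: L2dot_sqr_le; [exact: ut_L2|exact: u_L2]. Qed.

Lemma solution_initial_energy :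
  X 0 + G 0 + y 0 = L2norm u1 ^+ 2 + H1norm u0 ^+ 2.
Proof.
case: u_sol => _ _ _ [e0 e1] _.
have -> : H1norm u0 ^+ 2 = L2norm u0 ^+ 2 + gradnorm u0 ^+ 2.
  by rewrite sqr_sqrtr// addr_ge0 ?sqr_ge0.
rewrite /G -gradnorm_sqr /X /y -!L2norm_sqr.
rewrite (L2norm_ae e0) (L2norm_ae e1) (gradnorm_ae e0).
by ring.
Qed.

End weak_solution.

(** Squared, the claim is l^2 r^2 <= a w r^2 <= a C N^2. It serves with l = lambda(t), w = (1 +
    t)^b0 and r each of the three norms. *)
Lemma le_sqrt_div (R : realType) (l w a C N r : R) :
  0 < l -> 0 <= a -> 0 <= C ->
  0 <= N -> 0 <= r -> l ^+ 2 <= w * a -> w * r ^+ 2 <= C * N ^+ 2 ->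
  r <= Num.sqrt (a * C) / l * N.
Proof.
move=> l0 a0 C0 N0 r0 lw wr.
rewrite mulrAC ler_pdivlMr// -(@ler_pXn2r _ 2)// ?nnegrE; last 2 first.
- by rewrite mulr_ge0// ltW.
- by rewrite mulr_ge0// sqrtr_ge0.
rewrite !exprMn sqr_sqrtr; last exact: mulr_ge0.
rewrite (le_trans (ler_wpM2l (sqr_ge0 r) lw))// -[leRHS]mulrA.
by rewrite [leLHS](_ : _ = a * (w * r ^+ 2)); [exact: ler_wpM2l|ring].
Qed.

Theorem theorem3p1 (R : realType) (n : nat) (n_gt0 : (0 < n)%N)
    (b m : R -> R) (Ck : nat -> R) (b0 m0 : R) (lambda : R -> R)
    (b_C1 : hl_C1 b) (m_C1 : hl_C1 m)
    (b_le : forall (k : nat) (t : R), (k <= 1)%N -> 0 <= t ->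
      `|iter k hl_derive b t| <= Ck k * (1 / (1 + t)) ^+ k.+1)
    (m_le : forall (k : nat) (t : R), (k <= 1)%N -> 0 <= t ->
      `|iter k hl_derive m t| <= Ck k * (1 / (1 + t)) ^+ k.+2)
    (b_lim : (1 + t) * b t @[t --> +oo] --> b0)
    (m_lim : (1 + t) ^+ 2 * m t @[t --> +oo] --> m0)
    (b_int : (\int[lebesgue_measure]_(t in `[1%R, +oo[)
      (`|t * b t - b0| / t)%:E < +oo)%E)
    (m_int : (\int[lebesgue_measure]_(t in `[1%R, +oo[)
      (`|t ^+ 2 * m t - m0| / t)%:E < +oo)%E)
    (b0m0 : b0 * (b0 - 2) <= 4 * m0)
    (lambdaE : forall t,
      lambda t = expR (2^-1 * \int[lebesgue_measure]_(tau in `[0, t]) b tau)) :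
  exists C : R, forall u0 u1 : n.-tuple R -> R[i], H1 u0 -> L2 u1 ->
    forall u ut : R -> n.-tuple R -> R[i], solution b m u0 u1 u ut ->
    forall t : R, 0 <= t ->
      L2norm (fun x => ((1 + t)^-1)%:C%C * u t x)
        + gradnorm (u t) + L2norm (ut t)
      <= C / lambda t * (H1norm u0 + L2norm u1).
Proof.
have cb := hl_C1_continuous b_C1; have cm := hl_C1_continuous m_C1.
have b_le0 t : 0 <= t -> `|b t| <= Ck 0%N * (1 + t)^-1.
  by move=> t0; have := b_le 0%N t isT t0; rewrite div1r.
have m_le0 t : 0 <= t -> `|m t| <= Ck 0%N * (1 + t)^-1 ^+ 2.
  by move=> t0; have := m_le 0%N t isT t0; rewrite div1r.
have [Gam [g [M [K [gK dGam cGam Gam0 GamM]]]]] :=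
  coefficient_majorant cb cm b_le0 m_le0 b_int m_int.
pose C0 := (2 + b0 ^+ 2 / 2) * (expR (2 * M) * (1 + `|b0| + `|m0 + b0 / 2|)).
have C0_ge0 : 0 <= C0.
  by rewrite !mulr_ge0 ?expR_ge0// !addr_ge0// divr_ge0// sqr_ge0.
(* One square root for each of the three norms; [expR M] compares lambda^2 with (1 + t)^b0. *)
exists (3 * Num.sqrt (expR M * C0)) => u0 u1 u0_H1 u1_L2 u ut u_sol t t0.
have mu0 : 0 <= m0 - b0 ^+ 2 / 4 + b0 / 2 by lra.
have [cy cz ce] := solution_scalar_cvg0 u_sol.
have ge0 (w : R -> n.-tuple R -> R[i]) (s : R) :
  0 <= s -> 0 <= L2dot (w s) (w s).
  by move=> _; exact: L2dot_ge0.
have [] := @energy_inequality R b0 m0 M K b m g Gam _ _ _ _ mu0 gK dGam cGam Gam0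
  (fun s s0 => (GamM s s0).1)
  (fun s s0 => let: And3 d _ _ := solution_scalar_equations cb cm u_sol s0 in d)
  (fun s s0 => let: And3 _ d _ := solution_scalar_equations cb cm u_sol s0 in d)
  (fun s s0 => let: And3 _ _ d := solution_scalar_equations cb cm u_sol s0 in d)
  cy cz ce (ge0 u) (ge0 ut) _ (solution_gram u_sol) t t0.
  by move=> s _; apply: sumr_ge0 => i _; exact: L2dot_ge0.
rewrite (solution_initial_energy u_sol) -gradnorm_sqr -!L2norm_sqr.
set N := L2norm u1 ^+ 2 + _.
have N_le : N <= (H1norm u0 + L2norm u1) ^+ 2.
  have : 0 <= H1norm u0 * L2norm u1 by rewrite mulr_ge0 ?sqrtr_ge0// L2norm_ge0.
  by rewrite /N; lra.
have bnd (w r : R) : w * r ^+ 2 <= (2 + b0 ^+ 2 / 2) * (expR (2 * M) *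
    ((1 + `|b0| + `|m0 + b0 / 2|) * N)) ->
    w * r ^+ 2 <= C0 * (H1norm u0 + L2norm u1) ^+ 2.
  move=> /le_trans; apply; rewrite [leLHS](_ : _ = C0 * N).
    exact: ler_wpM2l.
  by rewrite /C0 !mulrA.
rewrite -exprMn => /bnd bX /bnd bG /bnd bu.
have lt0 : 0 < lambda t by rewrite lambdaE expR_gt0.
have ll : lambda t ^+ 2 <= expR (b0 * ln (1 + t)) * expR M.
  rewrite lambdaE -expRM_natl -expRD ler_expR mulrA mulfV// mul1r.
  exact: (GamM t t0).2.
have HL : 0 <= H1norm u0 + L2norm u1 by rewrite addr_ge0 ?sqrtr_ge0 ?L2norm_ge0.
have step r (r0 : 0 <= r) :=
  @le_sqrt_div R (lambda t) _ _ C0 _ r lt0 (expR_ge0 M) C0_ge0 HL r0 ll.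
have q0 : 0 <= (1 + t)^-1 by rewrite invr_ge0; lra.
have u_t : L2 (u t) by case: u_sol => H _ _ _ _; have [[]] := H t t0.
rewrite L2normZ// (ger0_norm q0).
have H1 := step _ (mulr_ge0 q0 (L2norm_ge0 (u t))) bu.
have H2 := step (gradnorm (u t)) (sqrtr_ge0 _) bG.
have H3 := step _ (L2norm_ge0 (ut t)) bX.
rewrite [leRHS](_ : _ = 3 * (Num.sqrt (expR M * C0) / lambda t *
  (H1norm u0 + L2norm u1))); last by rewrite !mulrA.
by lra.
Qed.
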